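(* (1) A tree set is isomorphic to the edge tree set $\tau(T)$ of some tree-like space $T$ if and only if it is regular. (2) Every regular tree set $\tau'$ is isomorphic (as a separation system) to $\tau(T(\tau'))$. (3) Every tree-like space $T'$ is isomorphic (as a graph-like space) to $T(\tau(T'))$.
   Context: Separation systems: a poset $(\vec S,\le)$ with order-reversing involution $^*$ (write $\overleftarrow s=\vec s^{\,*}$, $s=\{\vec s,\overleftarrow s\}$). $\vec s$ is small if $\vec s\le\overleftarrow s$; regular = no small elements; $\vec s$ is trivial if there is $\vec r$, $r\ne s$, with $\vec s\le\vec r,\overleftarrow r$; separations are nested if they have comparable orientations; a tree set is a nested separation system with no trivial elements. Isomorphism: bijection with $f,f^{-1}$ order-preserving and commuting with the involution. An orientation $O$ of $\tau$ contains exactly one of $\vec s,\overleftarrow s$ for each $s$; it is consistent if $\vec r,\vec s\in O$ and $\overleftarrow s\le\vec r$ imply $r=s$. $O(\vec s)$ is the unique consistent orientation in which $\vec s$ is maximal. Graph-like space: a topological space $G$ with vertex set $V(G)$, edge set $E(G)$, underlying set $V(G)\sqcup((0,1)\times E(G))$, and for each $e$ a continuous $\iota_e:[0,1]\to G$ with $\iota_e(x)=(x,e)$ for $x\in(0,1)$, $\iota_e(0),\iota_e(1)\in V(G)$ (end-vertices), $\iota_e|_{(0,1)}$ open, and such that any two distinct vertices lie in disjoint open sets $U,U'$ partitioning $V(G)$. A loop is an edge with $\iota_e(0)=\iota_e(1)$. $G-e$ is the subspace obtained by deleting the inner points of $e$. Isomorphism of graph-like spaces: a homeomorphism inducing a bijection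 of vertex sets. A pseudo-arc is a compact connected graph-like space with vertices $a,b$ such that for each edge $e$, $a,b$ lie in different components of $P-e$. A tree-like space is a compact, loop-free, connected graph-like space $G$ such that $G-e$ is disconnected for every edge $e$; it has a unique pseudo-arc $P(u,v)$ between any two vertices. Edge tree set $\tau(T)$ of a tree-like space $T$: ground set $\{(\iota_e(0),\iota_e(1)),(\iota_e(1),\iota_e(0)):e\in E(T)\}$, involution $(x,y)^*=(y,x)$, and $(x,y)<(v,w)$ iff $\{x,y\}\neq\{v,w\}$ and $P(y,v)\subseteq P(x,v)\subseteq P(x,w)$. Tree-like space $T(\tau)$ of a regular tree set $\tau$: vertex set the set of consistent orientations of $\tau$, edge set the set of unoriented separations of $\tau$. Fix any orientation $O'$ of $\tau$; for $\vec e\in O'$ let $\iota_e(0)=O(\overleftarrow e)$, $\iota_e(1)=O(\vec e)$. For $\vec e\in O'$ let $E^+(\vec e)=\{\vec s\in O': \vec e<\vec s\text{ or }\vec e<\overleftarrow s\}$, $E^-(\vec e)=\{\vec s\in O':\vec s<\vec e\}$, and for $r\in(0,1)$ set $S(\vec e,r)=\{O:\vec e\in O\}\cup((0,1)\times E^+(\vec e))\cup((r,1)\times\{e\})$ and $S(\overleftarrow e,r)=\{O:\overleftarrow e\in O\}\cup((0,1)\times E^-(\vec e))\cup((0,r)\times\{e\})$ (here $(0,1)\times E^\pm$ means inner points of the underlying unoriented edges). The topology is generated by the subbase of all $S(\vec e,r)$, $\vec e\in\tau$, $r\in(0,1)$.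
   Formalization: Graph-like spaces are also required to be Hausdorff (the listed axioms do not imply it, and (3) fails without it), and E^-(e) is taken as {s in O' : s<e or s^*<e}, since for an inconsistent O' the literal formula makes some iota_s discontinuous. *)

(* Defs.v *)
From HB Require Import structures.
From mathcomp Require Import all_boot all_order all_algebra.
From mathcomp Require Import all_classical all_reals all_analysis.

Set Implicit Arguments.
Unset Strict Implicit.
Unset Printing Implicit Defensive.
Import Order.TTheory GRing.Theory Num.Theory.
Import numFieldNormedType.Exports.

Local Open Scope classical_set_scope.
Local Open Scope ring_scope.

(* The axioms of a separation system are the separate predicate
   [separation_system]: [edge_tree_set] below is defined on plain data. *)
Record sep_data := SepData {
  sep :> Type;
  sle : sep -> sep -> Prop;
  sinv : sep -> sep }.

Arguments sle {_} _ _.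
Arguments sinv {_} _.

Definition slt (S : sep_data) (r s : S) : Prop := sle r s /\ r <> s.

(* The unoriented separation underlying [s]. *)
Definition unor (S : sep_data) (s : S) : set S := [set s; sinv s].

Record separation_system (S : sep_data) : Prop := {
  sle_refl : forall s : S, sle s s;
  sle_anti : forall r s : S, sle r s -> sle s r -> r = s;
  sle_trans : forall s r t : S, sle r s -> sle s t -> sle r t;
  sinvK : forall s : S, sinv (sinv s) = s;
  sinv_rev : forall r s : S, sle r s -> sle (sinv s) (sinv r) }.

Definition small (S : sep_data) (s : S) : Prop := sle s (sinv s).

Definition regular (S : sep_data) : Prop := forall s : S, ~ small s.

Definition trivial_sep (S : sep_data) (s : S) : Prop :=
  exists r : S, [/\ unor r <> unor s, sle s r & sle s (sinv r)].

Definition nested (S : sep_data) (r s : S) : Prop :=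
  exists r' s', [/\ unor r r', unor s s' & sle r' s' \/ sle s' r'].

Record tree_set (S : sep_data) : Prop := {
  tree_set_sep : separation_system S;
  tree_set_nested : forall r s : S, nested r s;
  tree_set_nontrivial : forall s : S, ~ trivial_sep s }.

Definition sep_iso (S S' : sep_data) : Prop :=
  exists (f : S -> S') (g : S' -> S),
    [/\ cancel f g, cancel g f,
        forall r s, sle r s -> sle (f r) (f s),
        forall r s, sle r s -> sle (g r) (g s) &
        (forall s, f (sinv s) = sinv (f s)) /\
        (forall s, g (sinv s) = sinv (g s))].

Definition orientation (S : sep_data) (O : set S) : Prop :=
  forall s, exists! t, unor s t /\ O t.

Definition consistent (S : sep_data) (O : set S) : Prop :=
  forall r s, O r -> O s -> sle (sinv s) r -> unor r = unor s.

Definition consistent_orientation (S : sep_data) (O : set S) : Prop :=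
  orientation O /\ consistent O.

Definition maximal_in (S : sep_data) (O : set S) (s : S) : Prop :=
  O s /\ forall t, O t -> sle s t -> t = s.

Section OrientationAt.
Variable S : sep_data.
Hypotheses (treeS : tree_set S) (regS : regular S).

Let sepS := tree_set_sep treeS.

Let down (s : S) : set S := [set r | sle r s \/ slt s (sinv r)].

Let nsmall (s : S) : ~ sle (sinv s) s.
Proof. by move=> h; apply: (regS (s := sinv s)); rewrite /small (sinvK sepS). Qed.

Let sle_swap (r s : S) : sle r (sinv s) -> sle s (sinv r).
Proof. by move=> /(sinv_rev sepS); rewrite (sinvK sepS). Qed.

Let unor_inv (s : S) : unor (sinv s) = unor s.
Proof. by rewrite /unor (sinvK sepS) setUC. Qed.

Let unorP (r s : S) : unor r = unor s -> r = s \/ r = sinv s.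
Proof. by move=> h; have : unor s r by rewrite -h; left. Qed.

Let ntriv (s t : S) : sle s t -> sle s (sinv t) -> t = s \/ t = sinv s.
Proof.
move=> h1 h2; apply: unorP; apply: contrapT => ne.
by apply: (tree_set_nontrivial treeS (s := s)); exists t.
Qed.

Let down_total (s t : S) : down s t \/ down s (sinv t).
Proof.
have K := sinvK sepS; have ref := sle_refl sepS.
have [t' [s' [tt' ss' cmp]]] := tree_set_nested treeS t s.
have ge u : sle s u -> down s u \/ down s (sinv u).
  move=> h; have [<-|ne] := pselect (s = u); first by left; left.
  by right; right; rewrite K.
have inv u : down s u \/ down s (sinv u) ->
    down s (sinv u) \/ down s (sinv (sinv u)).
  by rewrite K => -[]; [right|left].
have le u : sle u s -> down s u \/ down s (sinv u) by left; left.
have : down s t' \/ down s (sinv t').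
  case: ss' cmp => -> [] h; [exact: le|exact: ge| |].
  - by rewrite -(K t'); apply: inv; apply: ge; apply: sle_swap.
  - by rewrite -(K t'); apply: inv; apply: le; rewrite -(K s);
      exact: (sinv_rev sepS).
by case: tt' => -> //; rewrite K => -[]; [right|left].
Qed.

Let down_excl (s t : S) : down s t -> down s (sinv t) -> False.
Proof.
have K := sinvK sepS; have tr := sle_trans sepS; have an := sle_anti sepS.
case=> [a|[a na]] [b|[]]; rewrite ?K.
- apply: (@nsmall s); apply: (tr t) => //.
  by rewrite -(K t); exact: (sinv_rev sepS).
- by move=> b; apply; exact: an.
- by apply: na; exact: an.
- move=> b nb; case: (ntriv b a) => e; first by rewrite e in nb.
  by rewrite e K in na.
Qed.

Let down_or (s : S) : orientation (down s).
Proof.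
move=> t; case: (down_total s t) => h.
  exists t; split; first by split => //; left.
  by move=> u [[->//|-> h']]; case: (down_excl h h').
exists (sinv t); split; first by split => //; right.
by move=> u [[->|->//] h']; case: (down_excl h' h).
Qed.

Let down_cons (s : S) : consistent (down s).
Proof.
have K := sinvK sepS; have tr := sle_trans sepS; have an := sle_anti sepS.
move=> r t; case=> [a|[a na]] [b|[b nb]] h; exfalso.
- apply: (@nsmall s); apply: (tr (sinv t)); first exact: (sinv_rev sepS).
  exact: tr a.
- by apply: nb; apply: an => //; exact: tr a.
- apply: na; apply: an => //; apply: tr b.
  by rewrite -(K t); exact: (sinv_rev sepS).
- case: (ntriv (tr _ _ _ b h) a) => e.
    by apply: nb; apply: an => //; rewrite -[s in sle _ s]e.
  by rewrite e K in na.
Qed.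

Lemma orientation_at_ex (s : S) :
  exists O, consistent_orientation O /\ maximal_in O s.
Proof.
have K := sinvK sepS; have an := sle_anti sepS.
exists (down s); split; first by split.
split; first by left; exact: sle_refl.
move=> t [a b|[a na] b]; first exact: an.
by case: (ntriv b a) => // e; rewrite e K in na.
Qed.

Lemma orientation_at_unique (s : S) (O O' : set S) :
  consistent_orientation O -> maximal_in O s ->
  consistent_orientation O' -> maximal_in O' s -> O = O'.
Proof.
have K := sinvK sepS.
suff eqD P : consistent_orientation P -> maximal_in P s -> P = down s.
  by move=> a b c d; rewrite (eqD _ a b) (eqD _ c d).
move=> [orP cP] [Ps mP].
have tot u : P u \/ P (sinv u).
  by have [w [[[->|->] ?] _]] := orP u; [left|right].
have excl u : P u -> P (sinv u) -> u = sinv u.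
  move=> a b; have [w [_ w1]] := orP u.
  by transitivity w; [symmetry|]; apply: w1; split=> //; [left|right].
have sub u : down s u -> P u.
  case=> [a|[a na]]; case: (tot u) => // Pu.
    have /unorP : unor (sinv u) = unor s.
      by apply: cP => //; exact: (sinv_rev sepS).
    case=> e; last by rewrite -(K u) e K.
    by case: (@nsmall s); rewrite -{1}e K.
  by case: na; rewrite (mP _ Pu a).
apply/seteqP; split=> // u Pu; case: (down_total s u) => // d.
have e := excl u Pu (sub _ d).
by case: (regS (s := u)); rewrite /small -e; exact: sle_refl.
Qed.

(* O(s), the unique consistent orientation in which s is maximal. *)
Definition orientation_at (s : S) : set S := projT1 (cid (orientation_at_ex s)).

Lemma orientation_at_consistent (s : S) :
  consistent_orientation (orientation_at s).
Proof. by rewrite /orientation_at; case: cid => O []. Qed.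

Lemma orientation_at_maximal (s : S) : maximal_in (orientation_at s) s.
Proof. by rewrite /orientation_at; case: cid => O []. Qed.

End OrientationAt.

Definition open_unit (R : realType) := {x : R | 0 < x < 1}.

(* The disjoint union of [V] and (0,1) x [E]. *)
Inductive gl_point (R : realType) (V E : Type) :=
  | Vertex of V
  | Inner of open_unit R & E.

Arguments Vertex {R V E}.
Arguments Inner {R V E}.

HB.instance Definition _ (R : realType) (V E : Type) :=
  gen_eqMixin (gl_point R V E).
HB.instance Definition _ (R : realType) (V E : Type) :=
  gen_choiceMixin (gl_point R V E).

(* The maps iota_e are determined by their end-vertices [end0 e] = iota_e(0) and
   [end1 e] = iota_e(1); see [edge_iota]. *)
Record graph_space (R : realType) := GraphSpace {
  vertex : Type;
  edge : Type;
  gopen : set (set (gl_point R vertex edge));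
  gopenT : gopen setT;
  gopenI : forall A B, gopen A -> gopen B -> gopen (A `&` B);
  gopenU : forall F : set (set (gl_point R vertex edge)),
    F `<=` gopen -> gopen (\bigcup_(A in F) A);
  end0 : edge -> vertex;
  end1 : edge -> vertex }.

Definition gspace (R : realType) (G : graph_space R) : Type :=
  gl_point R (vertex G) (edge G).

HB.instance Definition _ (R : realType) (G : graph_space R) :=
  Choice.on (gspace G).

Lemma gopen_bigU (R : realType) (G : graph_space R) (I : Type)
    (f : I -> set (gspace G)) :
  (forall i, gopen (f i)) -> gopen (\bigcup_i f i).
Proof.
move=> fo; rewrite (_ : \bigcup_i f i = \bigcup_(A in range f) A).
  by apply: gopenU => _ [i _ <-]; exact: fo.
by rewrite bigcup_image.
Qed.

HB.instance Definition _ (R : realType) (G : graph_space R) :=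
  isOpenTopological.Build (gspace G)
    (@gopenT R G) (@gopenI R G) (@gopen_bigU R G).

Section GraphLike.
Variables (R : realType) (G : graph_space R).

Definition vertices : set (gspace G) := range Vertex.

Definition inner (e : edge G) : set (gspace G) := range (Inner ^~ e).

(* iota_e, extended from [0,1] to [R] by constants. *)
Definition edge_iota (e : edge G) (x : R) : gspace G :=
  if insub x is Some t then Inner t e
  else if x <= 0 then Vertex (end0 e) else Vertex (end1 e).

(* Graph-like spaces are Hausdorff, but the clauses on vertices and edges alone
   do not imply it: the neighbourhoods of a vertex v could be the sets
   {v} + (punctured neighbourhood of an inner point of an edge). *)
Record graph_like : Prop := {
  iota_continuous : forall e, {within `[0, 1], continuous (edge_iota e)};
  iota_open : forall e (U : set R),
    U `<=` `]0, 1[ -> open U -> open (edge_iota e @` U);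
  vertices_separated : forall u v : vertex G, u <> v ->
    exists U U' : set (gspace G),
      [/\ open U, open U', U `&` U' = set0, vertices `<=` U `|` U' &
          U (Vertex u) /\ U' (Vertex v)];
  graph_like_hausdorff : hausdorff_space (gspace G) }.

(* The subset P is the underlying set of a graph-like subspace of G. *)
Definition subgraph (P : set (gspace G)) : Prop :=
  forall e, inner e `&` P !=set0 -> edge_iota e @` `[0, 1] `<=` P.

Definition pseudo_arc (P : set (gspace G)) (a b : vertex G) : Prop :=
  [/\ subgraph P, P (Vertex a) /\ P (Vertex b), compact P, connected P &
      forall e, inner e `<=` P ->
        ~ connected_component (P `\` inner e) (Vertex a) (Vertex b)].

(* [connected] holds of the empty set, hence the first clause. *)
Record tree_like : Prop := {
  tree_like_nonempty : [set: gspace G] !=set0;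
  tree_like_graph_like : graph_like;
  tree_like_compact : compact [set: gspace G];
  tree_like_loopless : forall e : edge G, end0 e <> end1 e;
  tree_like_connected : connected [set: gspace G];
  tree_like_cut : forall e, ~ connected (~` inner e) }.

(* P(u,v), meaningful when there is exactly one pseudo-arc from u to v. *)
Definition the_pseudo_arc (u v : vertex G) : set (gspace G) :=
  xget set0 [set P | pseudo_arc P u v].

Definition oriented_edges : set (vertex G * vertex G) :=
  [set p | exists e, p = (end0 e, end1 e) \/ p = (end1 e, end0 e)].

Definition edge_lt (p q : vertex G * vertex G) : Prop :=
  let: (x, y) := p in let: (v, w) := q in
  [/\ [set x; y] <> [set v; w],
      the_pseudo_arc y v `<=` the_pseudo_arc x v &
      the_pseudo_arc x v `<=` the_pseudo_arc x w].

Lemma oriented_edges_swap p :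
  oriented_edges p -> oriented_edges (p.2, p.1).
Proof. by move=> [e [->|->]]; exists e; [right|left]. Qed.

Definition edge_inv (p : oriented_edges) : oriented_edges :=
  exist _ ((val p).2, (val p).1) (mem_set (oriented_edges_swap (set_valP p))).

Definition edge_tree_set : sep_data :=
  SepData (fun p q : oriented_edges => p = q \/ edge_lt (val p) (val q))
          edge_inv.

End GraphLike.

Definition graph_like_iso (R : realType) (G G' : graph_space R) : Prop :=
  exists (f : gspace G -> gspace G') (g : gspace G' -> gspace G),
    [/\ cancel f g, cancel g f, continuous f, continuous g &
        f @` @vertices R G = @vertices R G'].

Section TreeSpace.
Variables (R : realType) (S : sep_data).

Definition ts_vertex : Type := [set O : set S | consistent_orientation O].

Definition ts_edge : Type := range (@unor S).

(* The argument O' serves to attach the topology to the type. *)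
Definition ts_point (O' : set S) : Type := gl_point R ts_vertex ts_edge.

Variable O' : set S.

(* E^+ and E^- as sets of unoriented edges. When O' is consistent, the
   disjunct [slt (sinv s) e] of E^- never holds for s in O'; for an arbitrary
   orientation it is needed. *)
Definition Eplus (e : S) : set ts_edge :=
  [set a | exists s, [/\ O' s, val a = unor s & slt e s \/ slt e (sinv s)]].

Definition Eminus (e : S) : set ts_edge :=
  [set a | exists s, [/\ O' s, val a = unor s & slt s e \/ slt (sinv s) e]].

(* For e in O', [half_plus e r] and [half_minus e r] are the sets S(e,r) and
   S(e^*,r). *)
Definition half_plus (e : S) (r : open_unit R) : set (ts_point O') :=
  [set p | match p with
           | Vertex o => val o e
           | Inner x a => Eplus e a \/ (val a = unor e /\ val r < val x)
           end].

Definition half_minus (e : S) (r : open_unit R) : set (ts_point O') :=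
  [set p | match p with
           | Vertex o => val o (sinv e)
           | Inner x a => Eminus e a \/ (val a = unor e /\ val x < val r)
           end].

Definition ts_subbase : set (set (ts_point O')) :=
  [set A | exists e r, O' e /\ (A = half_plus e r \/ A = half_minus e r)].

HB.instance Definition _ := Choice.on (ts_point O').
HB.instance Definition _ :=
  isSubBaseTopological.Build (ts_point O') ts_subbase id.

Lemma ts_openU (F : set (set (ts_point O'))) :
  F `<=` open -> open (\bigcup_(A in F) A).
Proof. by move=> Fo; exact: bigcup_open. Qed.

Hypotheses (treeS : tree_set S) (regS : regular S) (orO' : orientation O').

Lemma ts_rep_ex (a : ts_edge) : exists s, O' s /\ unor s = val a.
Proof.
have [t _ <-] := set_valP a; have [s [[[->|->] Os] _]] := orO' t.
  by exists t.
exists (sinv t); split=> //.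
by rewrite /unor (sinvK (tree_set_sep treeS)) setUC.
Qed.

(* The orientation in O' of an unoriented separation. *)
Definition ts_rep (a : ts_edge) : S := projT1 (cid (ts_rep_ex a)).

Definition ts_vertex_at (s : S) : ts_vertex :=
  exist _ (orientation_at treeS regS s)
    (mem_set (orientation_at_consistent treeS regS s)).

Definition tree_space : graph_space R :=
  @GraphSpace R ts_vertex ts_edge (@open (ts_point O'))
    openT (@openI (ts_point O')) ts_openU
    (fun a => ts_vertex_at (sinv (ts_rep a)))
    (fun a => ts_vertex_at (ts_rep a)).

End TreeSpace.

(* Main.v *)
(** In a tree-like space every edge [e] leaves exactly two components of
    [T - e], its sides, and a pseudo-arc from [u] to [v] must be the
    intersection of all sides that contain both [u] and [v].  The inclusions of
    pseudo-arcs that define the order of [tau(T)] then say exactly that one side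
    contains another: [tau(T)] is the set of sides ordered by reverse inclusion,
    which makes it a regular tree set.

    In [T(tau)] the sides of the edge [s] are the sets of orientations
    containing [s] and [sinv s] respectively, and [s <= t] iff every consistent
    orientation containing [t] contains [s]; this yields [tau(T(tau)) = tau].
    Compactness of [T(tau)] is seen on ultrafilters: one that contains no edge
    picks a side of every separation, hence a consistent orientation.  For
    connectedness, if [O] and [O'] lie in different parts of a clopen partition
    and [t] separates them, then one of [O(t)], [O(sinv t)] can replace [O'] or [O];
    so some pair across the partition agrees on any given finite set, and by
    compactness some pair agrees everywhere.

    Finally, sending a vertex [v] of [T'] to the set of oriented edges pointing
    to [v] extends to a continuous bijection from the compact space [T'] to the
    Hausdorff space [T(tau(T'))]; it is onto because finitely many sides chosen
    by a consistent orientation meet. *)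

Require Import Defs.
From HB Require Import structures.
From mathcomp Require Import all_boot all_order all_algebra.
From mathcomp Require Import all_classical all_reals all_analysis.
From Stdlib Require List.

Set Implicit Arguments.
Unset Strict Implicit.
Unset Printing Implicit Defensive.
Import Order.TTheory GRing.Theory Num.Theory.
Import numFieldNormedType.Exports.

Local Open Scope classical_set_scope.
Local Open Scope ring_scope.

Lemma set2_eq (T : Type) (a b c d : T) : [set a; b] = [set c; d] ->
  (a = c /\ b = d) \/ (a = d /\ b = c) \/ (a = b /\ c = d).
Proof.
move=> E; have h z : [set a; b] z <-> [set c; d] z by rewrite E.
case: ((h a).1 (or_introl erefl)) => /= h1;
case: ((h b).1 (or_intror erefl)) => /= h2;
case: ((h c).2 (or_introl erefl)) => /= h3;
case: ((h d).2 (or_intror erefl)) => /= h4; subst; tauto.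
Qed.

(** * Compact and connected sets *)

Section Topology.
Variable T : topologicalType.
Implicit Types A B C : set T.

(** The finite intersections form a filter base, and a cluster point of it lies in every closed
    [C i]. Finite subfamilies are lists with [List.In] because [I] is a bare type without decidable
    equality. *)
Lemma compact_common_point (I : Type) (C : I -> set T) :
  compact [set: T] -> (forall i, closed (C i)) ->
  (forall l : seq I, exists z, forall i, List.In i l -> C i z) ->
  exists z, forall i, C i z.
Proof.
move=> cT cC fin.
pose W (l : seq I) := [set z | forall i, List.In i l -> C i z].
have WF : ProperFilter (filter_from [set: seq I] W).
  apply: filter_from_proper; last by move=> l _; exact: fin.
  apply: filter_from_filter; first by exists [::].
  move=> l k _ _; exists (l ++ k) => // z Wz.
  by split=> i il; apply: Wz; apply/List.in_app_iff; [left|right].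
have [z [_ cz]] := cT _ WF filterT.
exists z => i; apply: cC => B Bz; apply: cz => //.
by exists [:: i] => // y; apply; left.
Qed.

Lemma closed_separated A B :
  closed A -> closed B -> A `&` B = set0 -> separated A B.
Proof. by move=> cA cB AB; split; rewrite -(closure_id _).1. Qed.

Lemma open_separated A B :
  open A -> open B -> A `&` B = set0 -> separated A B.
Proof.
move=> oA oB AB; split; apply/seteqP; split=> // z [].
  by move=> cz Bz; have [y] := cz B (open_nbhs_nbhs (conj oB Bz)); rewrite AB.
by move=> Az cz; have [y] := cz A (open_nbhs_nbhs (conj oA Az));
  rewrite setIC AB.
Qed.

Lemma connected_subset_closed A B C : connected C -> closed A -> closed B ->
  A `&` B = set0 -> C `<=` A `|` B -> C `<=` A \/ C `<=` B.
Proof. by move=> cC cA cB AB; move/connected_subset; apply;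
  first exact: closed_separated. Qed.

(** The closure of either part of a separation stays inside the closed set [A] and misses the other
    part, so both parts are closed. *)
Lemma disconnected_closed A : closed A -> ~ connected A ->
  exists E : bool -> set T, [/\ forall b, E b !=set0, forall b, closed (E b),
    A = E false `|` E true & E false `&` E true = set0].
Proof.
move=> cA /connectedPn[E [E0 AE sE]]; exists E; split=> //; last first.
  exact: separated_disjoint.
case: sE => s1 s2; have sA b : closure (E b) `<=` A.
  rewrite (closure_id A).1 //; apply: closureS; rewrite AE.
  by case: b; [right|left].
case=> z cz; have := sA _ _ cz; rewrite AE => -[] // Ez.
  by have : set0 z by rewrite -s2; split.
by have : set0 z by rewrite -s1; split.
Qed.

Lemma connected_closedP A : closed A ->
  (forall B C, closed B -> closed C -> B `&` C = set0 -> A = B `|` C ->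
     B = set0 \/ C = set0) -> connected A.
Proof.
move=> cA h; apply: contrapT => /(disconnected_closed cA)[E [E0 cE AE dE]].
by case: (h _ _ (cE false) (cE true) dE AE) => e;
  [have := E0 false|have := E0 true]; rewrite e => -[].
Qed.

(** Two disjoint closed parts of the intersection have disjoint open neighbourhoods [U] and [V] by
    normality. By compactness some finite intersection already lies in their union, and its
    connectedness confines it to one of them. *)
Lemma connected_inter (R : realType) (I : Type) (C : I -> set T) :
  hausdorff_space T -> compact [set: T] -> (forall i, closed (C i)) ->
  (forall l : seq I, connected [set z | forall i, List.In i l -> C i z]) ->
  connected [set z | forall i, C i z].
Proof.
move=> hT cT cC fin.
apply: connected_closedP.
  rewrite (_ : [set z | _] = \bigcap_i C i); last first.
    by apply/seteqP; split=> z h i; [move=> _; exact: h|exact: (h i)].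
  by apply: closed_bigI.
move=> A B cA cB AB E; apply: contrapT =>
  /not_orP[/eqP/set0P[a Aa] /eqP/set0P[b Bb]].
have /(@normal_openP R) nT := compact_normal hT cT.
have [U [V [oU oV AU BV UV]]] := nT _ _ cA cB AB.
have [[l hl]|nl] := pselect (exists l : seq I,
    [set z | forall i, List.In i l -> C i z] `<=` U `|` V); last first.
  (* The index [None] adds the complement of the union of [U] and [V] to the family. A common point
     would lie in the whole intersection and yet outside both neighbourhoods. *)
  have [||z hz] := @compact_common_point (option I)
    (fun o => if o is Some i then C i else ~` (U `|` V)) cT.
  - by case=> [i|] //=; apply: open_closedC; exact: openU.
  - move=> l; apply: contrapT => h; apply: nl; exists (pmap id l) => z hz.
    apply: contrapT => nUV; apply: h; exists z => -[i|] il //; apply: hz.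
    elim: l il => [//|[j|] l IH]; rewrite /=.
      by case=> [[->]|/IH ?]; [left|right].
    by case=> // /IH.
  - have : [set z | forall i, C i z] z by move=> i; exact: (hz (Some i)).
    have := hz None; rewrite E => nUV [/AU|/BV]; move=> ?; apply: nUV;
      by [left|right].
have sUV := open_separated oU oV UV.
have Ca : [set z | forall i, C i z] a by rewrite E; left.
have Cb : [set z | forall i, C i z] b by rewrite E; right.
have disj z : U z -> V z -> False by move=> u v; have : set0 z by rewrite -UV.
case: (connected_subset sUV hl (fin l)) => h.
  by apply: (disj b); [apply: h => i _; exact: Cb|exact: BV].
by apply: (disj a); [exact: AU|apply: h => i _; exact: Ca].
Qed.

End Topology.

(** * Sides of edges and pseudo-arcs *)

Section GraphLike.
Variables (R : realType) (G : graph_space R).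
Local Notation X := (gspace G).
Implicit Types (e f : edge G) (b c : bool) (u v w : vertex G).

(** Booleans index the ends, and later the sides and orientations of an edge, so that [~~ b] is the
    opposite one and a single argument serves both. *)
Definition end_vertex e b : vertex G := if b then end1 e else end0 e.

Definition closed_edge e : set X := edge_iota e @` `[0, 1].

Lemma half_unit_subproof : 0 < (2^-1 : R) < 1.
Proof. by rewrite invr_gt0 ltr0n invf_lt1 ?ltr1n. Qed.

Definition half_unit : open_unit R := 
  exist (fun x : R => is_true (0 < x < 1)) _ half_unit_subproof.

Lemma edge_iota_inner e (t : open_unit R) : edge_iota e (val t) = Inner t e.
Proof. by rewrite /edge_iota valK. Qed.

Lemma edge_iota_le0 e x : x <= 0 -> edge_iota e x = Vertex (end0 e).
Proof.
move=> x0; rewrite /edge_iota; case: insubP => [t /andP[]|_];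
  last by rewrite x0.
by rewrite ltNge x0.
Qed.

Lemma edge_iota_ge1 e x : 1 <= x -> edge_iota e x = Vertex (end1 e).
Proof.
move=> x1; rewrite /edge_iota; case: insubP => [t /andP[_]|_].
  by rewrite ltNge x1.
by rewrite leNgt (lt_le_trans ltr01 x1).
Qed.

Lemma edge_iota01 e x : 0 < x < 1 -> exists2 t, val t = x &
  edge_iota e x = Inner t e.
Proof. by move=> h; exists (exist (fun x : R => is_true (0 < x < 1)) x h);
  rewrite -?edge_iota_inner. Qed.

Lemma inner_iota e : inner e = edge_iota e @` `]0, 1[.
Proof.
apply/seteqP; split=> [_ [t _ <-]|_ [x /= + <-]].
  by exists (val t); [rewrite /= in_itv /= (valP t)|exact: edge_iota_inner].
by rewrite in_itv /= => /(edge_iota01 e)[t _ ->]; exists t.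
Qed.

Lemma closed_edgeE e :
  closed_edge e = inner e `|`
    [set Vertex (end_vertex e false); Vertex (end_vertex e true)].
Proof.
apply/seteqP; split=> [_ [x /= + <-]|].
  rewrite in_itv /= => /andP[]; rewrite le_eqVlt => /orP[/eqP <- _|x0].
    by right; left; rewrite edge_iota_le0.
  rewrite le_eqVlt => /orP[/eqP ->|x1]; first by right; right;
    rewrite edge_iota_ge1.
  by have [|t _ ->] := @edge_iota01 e x; [rewrite x0|left; exists t].
move=> _ [[t _ <-]|[->|->]].
- exists (val t); last exact: edge_iota_inner.
  by have /andP[/ltW a /ltW c] := valP t; rewrite /= in_itv /= a c.
- by exists 0; [rewrite /= in_itv /= lexx ler01|rewrite edge_iota_le0].
- by exists 1; [rewrite /= in_itv /= lexx ler01|rewrite edge_iota_ge1].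
Qed.

Lemma inner_closed_edge e : inner e `<=` closed_edge e.
Proof. by rewrite closed_edgeE => z; left. Qed.

Lemma end_closed_edge e b : closed_edge e (Vertex (end_vertex e b)).
Proof. by rewrite closed_edgeE; right; case: b; [right|left]. Qed.

Lemma vertex_not_inner e v : ~ inner e (Vertex v).
Proof. by case. Qed.

Lemma inner_edge_inj e f (t : open_unit R) : inner e (Inner t f) -> e = f.
Proof. by case=> s _ []. Qed.

Lemma closed_edge_inner_disjoint e f : e <> f -> closed_edge f `<=` ~` inner e.
Proof.
move=> ef z; rewrite closed_edgeE => -[[t _ <-] /inner_edge_inj //|].
by case=> -> /vertex_not_inner.
Qed.

Section GL.
Hypothesis glG : graph_like G.

Lemma open_inner e : open (inner e).
Proof.
rewrite inner_iota; apply: (iota_open glG) => //; exact: interval_open.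
Qed.

Lemma compact_closed_edge e : compact (closed_edge e).
Proof.
by apply: continuous_compact; [exact: iota_continuous|exact: segment_compact].
Qed.

Lemma closed_closed_edge e : closed (closed_edge e).
Proof.
by apply: compact_closed; [exact: graph_like_hausdorff|exact:
  compact_closed_edge].
Qed.

Lemma connected_closed_edge e : connected (closed_edge e).
Proof.
apply: connected_continuous_connected; last exact: iota_continuous.
by apply/connected_intervalP; exact: interval_is_interval.
Qed.

Lemma closed_setC_inner e : closed (~` inner e).
Proof. by apply: open_closedC; exact: open_inner. Qed.

Lemma closed_vertices : closed (@vertices R G).
Proof.
rewrite (_ : @vertices R G = \bigcap_e ~` inner e).
  by apply: closed_bigI => e _; exact: closed_setC_inner.
apply/seteqP; split=> [_ [v _ <-] e _ //|].
- exact: vertex_not_inner.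
- by move=> [v|t e] h; [exists v|case: (h e) => //; exists t].
Qed.

(* A closed piece of [A] that misses the end-vertex of [e] is separated from all
   the rest of [C], edge [e] included. *)
Lemma connected_cut (C A B : set X) e b : connected C ->
  closed_edge e `<=` C -> C `\` inner e = A `|` B ->
  closed A -> closed B -> A `&` B = set0 ->
  A (Vertex (end_vertex e b)) -> B (Vertex (end_vertex e (~~ b))) ->
  connected A.
Proof.
move=> conC eC CAB cA cB AB Ab Bb.
have disj z : A z -> B z -> False by move=> a d; have : set0 z by rewrite -AB.
have gen A1 A2 : closed A1 -> closed A2 -> A1 `&` A2 = set0 -> A = A1 `|` A2 ->
    A1 (Vertex (end_vertex e b)) -> A2 = set0.
  move=> c1 c2 A12 AA A1b.
  have disj2 z : A1 z -> A2 z -> False by move=> a d;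
    have : set0 z by rewrite -A12.
  have A2A : A2 `<=` A by rewrite AA; right.
  have A2e z : A2 z -> closed_edge e z -> False.
    move=> A2z; rewrite closed_edgeE => -[ez|].
      have [_ /(_ ez)//] : (C `\` inner e) z by rewrite CAB; left; apply: A2A.
    have h c : z <> Vertex (end_vertex e c).
      move=> E; rewrite E in A2z; have [E'|E'] : c = b \/ c = ~~ b.
          by case: (c); case: (b); [left|right|right|left].
        by rewrite E' in A2z; exact: disj2 A2z.
      by rewrite E' in A2z; apply: (disj _ (A2A _ A2z)).
    by case; exact: h.
  have [||||h|h] := @connected_subset_closed _ (A1 `|` closed_edge e `|` B) A2 C
    conC => //.
  - by apply: closedU => //; apply: closedU => //; exact: closed_closed_edge.
  - apply/seteqP; split=> // z [[[a|a]|a] a2].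
    + exact: disj2 a2.
    + exact: A2e a.
    + exact: (disj z (A2A _ a2)).
  - move=> z Cz; have [ze|ze] := pselect (inner e z).
      by left; left; right; exact: inner_closed_edge.
    have : (C `\` inner e) z by [].
    by rewrite CAB AA => -[[a|a]|a]; [left; left; left|right|left; right].
  - apply/seteqP; split=> // z a2.
    have Cz : C z by have [] : (C `\` inner e) z by rewrite CAB; left;
      exact: A2A.
    case: (h _ Cz) => [[a|a]|a].
    + by case: (disj2 z).
    + by case: (A2e z).
    + by case: (disj z) => //; exact: A2A.
  - by case: (A2e (Vertex (end_vertex e b))); [apply: h; apply: eC|];
      exact: end_closed_edge.
apply: connected_closedP => // A1 A2 c1 c2 A12 AA.
have : A (Vertex (end_vertex e b)) by [].
rewrite {1}AA => -[] h; [right; exact: (gen A1)|left; apply: (gen A2) => //].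
  by rewrite setIC.
by rewrite setUC.
Qed.

End GL.
End GraphLike.

(** * Sides and pseudo-arcs in tree-like spaces *)

Section TreeLike.
Variables (R : realType) (G : graph_space R).
Hypothesis tlG : tree_like G.
Let glG := tree_like_graph_like tlG.
Let hG := graph_like_hausdorff glG.
Let cG := tree_like_compact tlG.
Local Notation X := (gspace G).
Implicit Types (e f : edge G) (b c : bool) (u v w : vertex G).

Definition side e b : set X :=
  connected_component (~` inner e) (Vertex (end_vertex e b)).

(** Deleting the edge leaves two nonempty closed parts. Each contains exactly one end, so they can
    be indexed by the ends, and [connected_cut] with the whole space as [C] makes each of them
    connected. *)
Lemma sides_ex e : exists E : bool -> set X,
  [/\ forall b, closed (E b), forall b, connected (E b),
      ~` inner e = E false `|` E true, E false `&` E true = set0 &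
      forall b, E b (Vertex (end_vertex e b))].
Proof.
have [E [E0 cE AE dE]] :=
  disconnected_closed (closed_setC_inner glG (e := e))
    (tree_like_cut tlG (e := e)).
(* If both ends were in [E b], then [E b] together with the closed edge would be a closed set
   disjoint from the other part, and the two would disconnect the whole space. *)
have diff b : ~ (E b (Vertex (end_vertex e false)) /\ E b
  (Vertex (end_vertex e true))).
  move=> [Ef Et]; have [x Ex] := E0 (~~ b).
  have dEb : E b `&` E (~~ b) = set0 by case: (b) => //=; rewrite setIC.
  have disj z : E b z -> E (~~ b) z -> False.
    by move=> a d; have : set0 z by rewrite -dEb.
  have AEb : ~` inner e = E b `|` E (~~ b) by rewrite AE; case: (b) => //=;
    rewrite setUC.
  have De z : E (~~ b) z -> closed_edge e z -> False.
    move=> Ez; rewrite closed_edgeE => -[ez|[zE|zE]].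
    - by have : (~` inner e) z by rewrite AEb; right.
    - by rewrite zE in Ez; exact: disj Ez.
    - by rewrite zE in Ez; exact: disj Ez.
  have [||||h|h] := @connected_subset_closed _ (E b `|` closed_edge e)
    (E (~~ b)) setT
      (tree_like_connected tlG) => //.
  - by apply: closedU => //; exact: closed_closed_edge.
  - by apply/seteqP; split=> // z [[a|a] d]; [exact: (disj z)|exact: (De z)].
  - move=> z _; have [ze|ze] := pselect (inner e z).
      by left; right; exact: inner_closed_edge.
    have : (~` inner e) z by [].
    by rewrite AEb => -[?|?]; [left; left|right].
  - by case: (h x) => // a; [exact: (disj x)|exact: (De x)].
  - by apply: (disj _ Ef); apply: h.
have [F [F0 cF AF dF]] : exists F : bool ->
  set X, [/\ forall b, F b (Vertex (end_vertex e b)),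
    forall b, closed (F b), ~` inner e = F false `|` F true &
      F false `&` F true = set0].
  have ends b : E false (Vertex (end_vertex e b)) \/ E true
    (Vertex (end_vertex e b)).
    have : (~` inner e) (Vertex (end_vertex e b)) by exact: vertex_not_inner.
    by rewrite AE.
  case: (ends false) (ends true) => h0 [] h1.
  - by case: (diff false).
  - by exists E; split=> //; case.
  - by exists (fun b => E (~~ b)); split=> //;
      [case|rewrite setUC|rewrite setIC].
  - by case: (diff true).
exists F; split=> // b.
apply: (@connected_cut _ _ glG setT (F b) (F (~~ b)) e b) => //.
- exact: (tree_like_connected tlG).
- by rewrite setTD AF; case: (b) => //=; rewrite setUC.
- by case: (b) => //=; rewrite setIC.
Qed.

(** The parts given by [sides_ex] are closed, disjoint and connected, hence are the components of
    the two ends. *)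
Lemma side_props e :
  [/\ forall b, closed (side e b), ~` inner e = side e false `|` side e true &
      side e false `&` side e true = set0].
Proof.
have [E [cE conE AE dE E0]] := sides_ex e.
suff -> : side e = E by [].
apply/funext => b; apply/seteqP; split=> z; last first.
  move=> Ez; exists (E b) => //; split=> //; rewrite AE.
  by case: (b); [right|left].
case=> C [Cb CA conC Cz].
have [||||h|h] := @connected_subset_closed _ (E b) (E (~~ b)) C conC => //.
- by case: (b) => //=; rewrite setIC.
- by apply: (subset_trans CA); rewrite AE; case: (b) => //=; rewrite setUC.
- exact: h.
- suff : set0 (Vertex (end_vertex e b) : X) by [].
  by rewrite -dE; have := h _ Cb; have := E0 b; case: (b).
Qed.

Lemma closed_side e b : closed (side e b).
Proof. by have [] := side_props e. Qed.

Lemma connected_side e b : connected (side e b).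
Proof. exact: component_connected. Qed.

Lemma side_sub e b : side e b `<=` ~` inner e.
Proof. exact: connected_component_sub. Qed.

Lemma side_excl e b (z : X) : side e b z -> side e (~~ b) z -> False.
Proof.
by have [_ _ d] := side_props e => s1 s2; have : set0 z;
  [rewrite -d; case: b s1 s2|].
Qed.

Lemma side_total e b (z : X) : ~ inner e z -> side e b z \/ side e (~~ b) z.
Proof.
move=> ze; have : (~` inner e) z by [].
by have [_ -> _] := side_props e; case: b => -[]; by [left|right].
Qed.

Lemma side_end e b : side e b (Vertex (end_vertex e b)).
Proof. by apply: connected_component_refl; exact: vertex_not_inner. Qed.

Lemma sub_side e b (C : set X) (z : X) : connected C -> C `<=` ~` inner e ->
  C z -> side e b z -> C `<=` side e b.
Proof.
move=> conC Ce Cz sz y Cy.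
by apply: connected_component_trans sz _; exists C.
Qed.

(** A closed edge other than [e] is connected and avoids the inner points of [e], so one side of [e]
    contains all of it. *)
Lemma side_subgraph e b : subgraph (side e b).
Proof.
move=> f [z [fz sz]]; have [E|ef] := pselect (e = f).
  by rewrite E in sz; case: (side_sub sz).
apply: (sub_side (connected_closed_edge glG (e := f)) _ _ sz).
  exact: closed_edge_inner_disjoint.
exact: inner_closed_edge.
Qed.

Lemma side_edge e f b (z y : X) : e <> f -> closed_edge f z ->
  closed_edge f y ->
  side e b z -> side e b y.
Proof.
move=> ef fz fy sz; apply:
  (sub_side (connected_closed_edge glG (e := f)) _ fz sz) fy.
exact: closed_edge_inner_disjoint.
Qed.

(** If [C] meets the inside of [e], it contains both ends of [e] and [connected_cut] applies to its
    traces on the two sides. Otherwise [C] lies within the side of [v]. *)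
Lemma connected_subgraph_side (C : set X) e b v : closed C -> connected C ->
  subgraph C -> C (Vertex v) -> side e b (Vertex v) ->
    connected (C `&` side e b).
Proof.
move=> cC conC sC Cv sv; have [eC|/set0P/negP/negPn/eqP eC] :=
  pselect (inner e `&` C !=set0).
  have eC' := sC _ eC.
  apply: (@connected_cut _ _ glG C _ (C `&` side e (~~ b)) e b) => //.
  - rewrite -setIUr setDE; congr (_ `&` _).
    by have [_ -> _] := side_props e; case: (b) => //; rewrite setUC.
  - by apply: closedI => //; exact: closed_side.
  - by apply: closedI => //; exact: closed_side.
  - by apply/seteqP; split=> // z [[_ s1] [_ s2]]; exact: (side_excl s1 s2).
  - by split; [apply: eC'; exact: end_closed_edge|exact: side_end].
  - by split; [apply: eC'; exact: end_closed_edge|exact: side_end].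
rewrite (_ : C `&` side e b = C) //; apply/setIidPl.
apply: (sub_side conC _ Cv sv) => z Cz ez.
by have : set0 z by rewrite -eC.
Qed.

(** An explicit candidate for P(u,v): [pseudo_arc_arc] and [pseudo_arc_unique] show that it is the
    only pseudo-arc from [u] to [v]. *)
Definition arc u v : set X :=
  [set z | forall e b, side e b (Vertex u) -> side e b (Vertex v) ->
    side e b z].

Lemma arcC u v : arc u v = arc v u.
Proof. by apply/seteqP; split=> z h e b s1 s2; exact: h. Qed.

Lemma arcl u v : arc u v (Vertex u). Proof. by []. Qed.

Lemma arcr u v : arc u v (Vertex v). Proof. by []. Qed.

Let common_side u v := {p : edge G * bool |
  side p.1 p.2 (Vertex u) /\ side p.1 p.2 (Vertex v)}.

Lemma arcE u v : arc u v =
  [set z | forall i : common_side u v, side (projT1 i).1 (projT1 i).2 z].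
Proof.
apply/seteqP; split=> z h; first by case=> -[e b] /= [s1 s2]; exact: h.
by move=> e b s1 s2; exact: (h (exist _ (e, b) (conj s1 s2))).
Qed.

Lemma closed_arc u v : closed (arc u v).
Proof.
rewrite arcE (_ : [set z | _] = \bigcap_(i : common_side u v) side (projT1 i).1
  (projT1 i).2).
  by apply: closed_bigI => i _; exact: closed_side.
by apply/seteqP; split=> z h i; [move=> _; exact: h|exact: (h i)].
Qed.

Lemma arc_subgraph u v : subgraph (arc u v).
Proof.
move=> f [z [fz az]] y fy e b s1 s2.
by apply: (@side_subgraph e b f) fy; exists z; split=> //; exact: az.
Qed.

(** By [connected_inter] it suffices to intersect finitely many sides, and these are cut off one at
    a time by [connected_subgraph_side]. *)
Lemma connected_arc u v : connected (arc u v).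
Proof.
rewrite arcE; apply: (@connected_inter _ R (common_side u v)
  (fun i => side (projT1 i).1 (projT1 i).2) hG cG); first by move=> i;
    exact: closed_side.
move=> l; set W := [set z | _].
(* The induction carries along the properties that the next cut requires. *)
suff [] : [/\ connected W, closed W & subgraph W] by [].
rewrite {}/W; elim: l => [|i l [conW cW sW]].
  rewrite (_ : [set z | _] = setT); last by apply/seteqP; split=> // z _ i [].
  by split=> //; exact: (tree_like_connected tlG).
rewrite (_ : [set z | _] = [set z | forall j : common_side u v, List.In j l ->
    side (projT1 j).1 (projT1 j).2 z] `&` side (projT1 i).1 (projT1 i).2);
      last first.
  apply/seteqP; split=> [z h|z [h1 h2] j /= [<-//|jl]]; last exact: h1.
  by split=> [j jl|]; apply: h; [right|left].
have [si1 si2] := projT2 i; split.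
- by apply: (connected_subgraph_side (v := u)) => // j _; have [] := projT2 j.
- by apply: closedI => //; exact: closed_side.
- move=> f [z [fz [Wz sz]]] y fy; split; first by apply: (sW f) fy; exists z.
  by apply: (@side_subgraph _ _ f) fy; exists z.
Qed.

(** If [u] and [v] were on the same side of [e], the arc would be contained in that side and could
    not meet the inside of [e]. *)
Lemma arc_inner u v e b (z : X) : arc u v z -> inner e z ->
  side e b (Vertex u) -> side e (~~ b) (Vertex v).
Proof.
move=> az ez su; case: (@side_total e b (Vertex v)) => //;
  first exact: vertex_not_inner.
by move=> sv; case: (side_sub (az _ _ su sv)).
Qed.

Lemma pseudo_arc_arc u v : pseudo_arc (arc u v) u v.
Proof.
split; first exact: arc_subgraph.
- by split; [exact: arcl|exact: arcr].
- exact: (subclosed_compact (@closed_arc u v) cG).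
- exact: connected_arc.
move=> e ie [C [Cu Ca conC Cv]].
have su : exists b, side e b (Vertex u).
  by case: (@side_total e true (Vertex u));
    [exact: vertex_not_inner|exists true|exists false].
case: su => b su; have iz : inner e (Inner (half_unit R) e) by
  exists (half_unit R).
have sv := arc_inner (ie _ iz) iz su.
have := sub_side conC (fun z Cz => (Ca z Cz).2) Cu su Cv.
by move=> sv'; exact: side_excl sv.
Qed.

(** The axiom that separates two vertices extends, by compactness, to a vertex and a closed set:
    finitely many partitions suffice, whose first halves are united and second halves
    intersected. *)
Lemma vertex_separated_closed (Q : set X) w : closed Q -> ~ Q (Vertex w) ->
  exists U U' : set X, [/\ open U, open U', U `&` U' = set0,
    @vertices R G `<=` U `|` U' & Q `&` @vertices R G `<=` U /\ U' (Vertex w)].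
Proof.
move=> cQ nQw.
pose part (p : set X * set X) := [/\ open p.1, open p.2, p.1 `&` p.2 = set0,
    @vertices R G `<=` p.1 `|` p.2 & p.2 (Vertex w)].
pose C (o : option {p | part p}) : set X :=
  if o is Some i then ~` (projT1 i).1 else Q `&` @vertices R G.
(* Each vertex of [Q] lies in the first half of some partition, so the sets [C] have no common
   point, and already finitely many of them have none. *)
have [[l hl]|nl] := pselect (exists l : seq (option {p | part p}),
    ~ exists z, forall i, List.In i l -> C i z); last first.
  have [||z hz] := @compact_common_point X _ C cG.
  - case=> [i|] /=; first by apply: open_closedC; have [] := projT2 i.
    by apply: closedI => //; exact: closed_vertices.
  - by move=> l; apply: contrapT => h; apply: nl; exists l.
  - have [Qz [v _ vz]] := hz None.
    have vw : v <> w by move=> E; apply: nQw; rewrite -E vz.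
    have [U [U' [oU oU' UU' VU [Uv U'w]]]] := vertices_separated glG vw.
    have p : part (U, U') by [].
    by have := hz (Some (exist _ _ p)); rewrite /= -vz.
have [[U U'] [pU hU]] : exists p, part p /\
    forall i, List.In (Some i) l -> (projT1 i).1 `<=` p.1.
  elim: l {hl} => [|[i|] l [[U U'] [[oU oU' UU' VU U'w] hU]]].
  - exists (set0, setT); split=> //; split=> //=;
      [exact: open0|exact: openT|by rewrite set0I|].
    by move=> z _; right.
  - have := projT2 i; set p := projT1 i => -[oP oP' PP' VP P'w].
    exists (U `|` p.1, U' `&` p.2); split; last first.
      by move=> j /= [[<-]|/hU/= jU] z jz; [right|left; exact: jU].
    split=> //=; [exact: openU|exact: openI| |].
    + apply/seteqP; split=> // z [[Uz|pz] [U'z p'z]].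
        by have : set0 z by rewrite -UU'; split.
      by have : set0 z by rewrite -PP'; split.
    + move=> z Vz; case: (VU _ Vz) => [?|a]; first by left; left.
      by case: (VP _ Vz) => [?|d]; [left; right|right].
  - by exists (U, U'); split=> // j /= [//|/hU].
case: pU => oU oU' UU' VU U'w; exists U, U'; split=> //; split=> //.
move=> z [Qz Vz]; apply: contrapT => nUz; apply: hl; exists z.
by case=> [i|] il //= iz; apply: nUz; exact: hU iz.
Qed.

(** [Q] cannot leave a side of [e] that contains [u] and [v]: it would have to use [e], yet its
    trace on that side would join [u] to [v] without [e]. Conversely, each edge of the arc separates
    [u] from [v], so the connected [Q] uses it; the missing vertices are handled by a clopen piece
    of the arc. *)
Lemma pseudo_arc_unique (Q : set X) u v : pseudo_arc Q u v -> Q = arc u v.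
Proof.
move=> [sQ [Qu Qv] kQ conQ cutQ]; have cQ := compact_closed hG kQ.
have QA : Q `<=` arc u v.
  move=> z Qz e b su sv.
  have [eQ|/set0P/negP/negPn/eqP eQ] := pselect (inner e `&` Q !=set0);
    last first.
    apply: (sub_side conQ _ Qu su) Qz => y Qy ey.
    by have : set0 y by rewrite -eQ.
  case: (cutQ e).
    by move=> y ey; apply: (sQ _ eQ); exact: inner_closed_edge.
  exists (Q `&` side e b) => //; split=> //.
    by move=> y [Qy sy]; split=> //; exact: side_sub sy.
  exact: connected_subgraph_side Qu su.
have edges t e : arc u v (Inner t e) -> Q (Inner t e).
  move=> az; have iz : inner e (Inner t e) by exists t.
  have [eQ|/set0P/negP/negPn/eqP eQ] := pselect (inner e `&` Q !=set0).
    by apply: (sQ _ eQ); exact: inner_closed_edge.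
  have [b su] : exists b, side e b (Vertex u).
    by case: (@side_total e true (Vertex u));
      [exact: vertex_not_inner|exists true|exists false].
  have sv := arc_inner az iz su; exfalso; apply: side_excl sv.
  apply: (sub_side conQ _ Qu su) Qv => y Qy ey.
  by have : set0 y by rewrite -eQ.
apply/seteqP; split=> // -[w|t e] aw; last exact: edges.
apply: contrapT => nQw.
have [U [U' [oU oU' UU' VU [QU U'w]]]] := vertex_separated_closed cQ nQw.
(* This piece of the arc is relatively open as it stands, and relatively closed as the set of
   vertices outside [U], since every inner point of the arc is in [Q]. It contains [w], hence is the
   whole arc, although [u] is in [Q]. *)
have K : arc u v `&` (U' `&` ~` Q) = arc u v.
  apply: (connected_arc (u := u) (v := v)); first by exists (Vertex w).
    exists (U' `&` ~` Q) => //; apply: openI => //; exact: closed_openC.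
  exists (@vertices R G `&` ~` U).
    by apply: closedI; [exact: closed_vertices|exact: open_closedC].
  apply/seteqP; split=> -[x|t e] [ax].
  - move=> [U'x nQx]; split=> //; split; first by exists x.
    by move=> Ux; have : set0 (Vertex x : X) by rewrite -UU'.
  - by move=> [_ []]; exact: edges.
  - move=> [Vx nUx]; split=> //; split; first by case: (VU _ Vx).
    by move=> Qx; apply: nUx; apply: QU.
  - by move=> [[]].
have : arc u v (Vertex u) by [].
by rewrite -K => -[_ [_]].
Qed.

Lemma the_pseudo_arcE u v : the_pseudo_arc u v = arc u v.
Proof.
rewrite /the_pseudo_arc; case: xgetP => [P -> /pseudo_arc_unique //|h].
by case: (h (arc u v)); exact: pseudo_arc_arc.
Qed.

(** A side of another edge contains both ends of [e] or neither, so only the sides of [e] can tell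
    the two arcs apart. This turns the inclusions in [edge_lt] into membership in a side. *)
Lemma arc_sub_side e b v :
  arc (end_vertex e b) v `<=` arc (end_vertex e (~~ b)) v <->
  side e b (Vertex v).
Proof.
split=> [sub|sv z az f c s1 s2].
  case: (@side_total e b (Vertex v)) => //; first exact: vertex_not_inner.
  move=> sv; have := sub _ (@arcl _ _) e (~~ b) (@side_end _ _) sv.
  by move=> /(side_excl (@side_end e b)).
have [E|fe] := pselect (f = e); last first.
  by apply: az => //; apply: (side_edge fe) s1; exact: end_closed_edge.
rewrite {f}E in s1 s2 *; exfalso.
have [cE|cE] : c = b \/ c = ~~ b by case: (c); case: (b);
  [left|right|right|left].
  by rewrite cE in s1; apply: (side_excl s1); exact: side_end.
by rewrite cE in s2; exact: side_excl s2.
Qed.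

Lemma arc_sub_sideN e b u :
  arc u (end_vertex e (~~ b)) `<=` arc u (end_vertex e b) <->
  side e (~~ b) (Vertex u).
Proof. by have := @arc_sub_side e (~~ b) u; rewrite negbK !(arcC u). Qed.

Lemma side_end_neg e b : ~ side e b (Vertex (end_vertex e (~~ b))).
Proof. by move=> s; apply: (side_excl s); exact: side_end. Qed.

Lemma side_neg e b v : ~ side e b (Vertex v) <-> side e (~~ b) (Vertex v).
Proof.
split=> [ns|s1 s2]; last exact: (side_excl s2).
by case: (@side_total e b (Vertex v)) => //; exact: vertex_not_inner.
Qed.

Lemma side_ends e f b c c' : e <> f ->
  side e b (Vertex (end_vertex f c)) -> side e b (Vertex (end_vertex f c')).
Proof. by move=> ef; apply: (side_edge ef); exact: end_closed_edge. Qed.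

(** * The edge tree set ordered by reverse inclusion of sides *)

Definition vside e b : set (vertex G) := [set v | side e b (Vertex v)].

(** The edge [e] lies in the opposite side of [f], so [side f c] is a connected set that avoids [e]
    and has a point in [side e b]. *)
Lemma side_sub_vside e f b c : e <> f -> side e b (Vertex (end_vertex f c)) ->
  side f (~~ c) (Vertex (end_vertex e b)) -> side f c `<=` side e b.
Proof.
move=> ef s1 s2.
apply: (sub_side (@connected_side f c) _ (@side_end f c) s1).
move=> z fz ez.
have : side f (~~ c) z.
  apply: (side_edge (nesym ef)) s2;
    [exact: end_closed_edge|exact: inner_closed_edge].
exact: side_excl fz.
Qed.

Lemma oriented_edge_subproof e b :
  oriented_edges (G := G) (end_vertex e (~~ b), end_vertex e b).
Proof. by exists e; case: b; [left|right]. Qed.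

(** The head is [end_vertex e b], so this orientation points to [side e b]. *)
Definition oriented_edge e b : edge_tree_set G :=
  (exist _ (end_vertex e (~~ b), end_vertex e b)
     (mem_set (@oriented_edge_subproof e b)) : @oriented_edges R G).

Lemma oriented_edgeP (p : edge_tree_set G) : exists e b, p = oriented_edge e b.
Proof.
have [e h] := set_valP p.
case: h => h; [exists e, true|exists e, false]; exact: val_inj.
Qed.

Lemma end_vertex_inj e b c : end_vertex e b = end_vertex e c -> b = c.
Proof.
have := tree_like_loopless tlG (e := e).
by case: b; case: c => //= h E; case: h.
Qed.

(** There are no parallel edges: a second edge with the same ends would connect the two sides of
    [e]. *)
Lemma end_vertices_inj e f b c : end_vertex e b = end_vertex f c ->
  end_vertex e (~~ b) = end_vertex f (~~ c) -> e = f.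
Proof.
move=> E1 E2; apply: contrapT => ef.
have := @side_end e b; rewrite E1 => /(@side_ends _ _ _ _ (~~ c) ef).
by rewrite -E2; exact: side_end_neg.
Qed.

Lemma oriented_edge_inj e f b c : oriented_edge e b = oriented_edge f c ->
  e = f /\ b = c.
Proof.
case=> E1 E2; have ef := end_vertices_inj E2 E1; split=> //.
by rewrite ef in E2; exact: end_vertex_inj E2.
Qed.

Lemma oriented_edgeN e b : sinv (oriented_edge e b) = oriented_edge e (~~ b).
Proof. by apply: val_inj; rewrite /= negbK. Qed.

(** For distinct edges the two arc inclusions say that [f] lies in [side e b] and [e] in
    [side f (~~ c)], which amounts to the inclusion of sides. For one edge, the two sides are
    incomparable. *)
Lemma edge_sleP e f b c : sle (oriented_edge e b) (oriented_edge f c) <->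
  vside f c `<=` vside e b.
Proof.
rewrite /= /edge_lt !the_pseudo_arcE; split.
  case=> [/oriented_edge_inj[-> ->]
    //|[ne /arc_sub_side s1 /arc_sub_sideN s2 v]].
  have ef : e <> f.
    move=> E; apply: ne; rewrite E; case: (b); case: (c) => //=; exact: setUC.
  by apply: (side_sub_vside ef);
    [exact: side_ends s1|apply: side_ends s2; exact/nesym].
move=> sub; have sf := sub _ (@side_end f c).
have [E|ef] := pselect (e = f).
  left; move: sf; rewrite E => sf; congr oriented_edge.
  apply: contrapT => bc; apply: (@side_end_neg f b).
  by rewrite (_ : ~~ b = c) //; case: (b) (c) bc => -[].
right; split.
- move=> /(@set2_eq (vertex G))[[E1 E2]|[[E1 E2]|[E1 _]]].
  + by apply: ef; exact: end_vertices_inj E2 E1.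
  + by apply: ef; apply: (@end_vertices_inj e f b (~~ c)) => //; rewrite negbK.
  + by have /end_vertex_inj := E1; case: (b).
- by apply/arc_sub_side; exact: side_ends sf.
- by apply/arc_sub_sideN/side_neg => /sub; exact: side_end_neg.
Qed.

Lemma vsideN e b : vside e (~~ b) = ~` vside e b.
Proof. by apply/seteqP; split=> v /side_neg. Qed.

Lemma edge_regular : regular (edge_tree_set G).
Proof.
move=> p; have [e [b ->]] := oriented_edgeP p; rewrite /small oriented_edgeN.
by move/edge_sleP => /(_ _ (@side_end e (~~ b)))/side_end_neg.
Qed.

Lemma edge_sle_or e f b c : e <> f ->
  side e b (Vertex (end_vertex f c)) ->
    side f (~~ c) (Vertex (end_vertex e b)) ->
  sle (oriented_edge e b) (oriented_edge f c).
Proof. by move=> ef s1 s2; apply/edge_sleP => v; exact: side_sub_vside. Qed.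

(** Through [edge_sleP] the axioms become facts about inclusion and complements. Two edges are
    nested because some side of each contains the other edge, and a trivial orientation would point
    to a side containing all vertices, its own tail included. *)
Lemma edge_tree_set_tree_set : tree_set (edge_tree_set G).
Proof.
have sysG : separation_system (edge_tree_set G).
  split.
  - by left.
  - move=> r s; have [e [b ->]] := oriented_edgeP r;
      have [f [c ->]] := oriented_edgeP s.
    move=> /edge_sleP h1 /edge_sleP h2.
    have E : vside e b = vside f c by apply/seteqP.
    have [ef|ef] := pselect (e = f).
      rewrite -ef in E *; congr oriented_edge.
      have : vside e c (end_vertex e b) by rewrite -E; exact: side_end.
      case: (b =P c) => // bc; rewrite (_ : b = ~~ c) => [/side_end_neg //|].
      by case: (b) (c) bc => -[].
    have : vside e b (end_vertex f (~~ c)).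
      by apply: (side_ends _ (c := c)) => //; apply: h1; exact: side_end.
    by rewrite E => /side_end_neg.
  - move=> s r t; have [e [b ->]] := oriented_edgeP r;
      have [f [c ->]] := oriented_edgeP s.
    have [g [d ->]] := oriented_edgeP t => /edge_sleP h1 /edge_sleP h2.
    by apply/edge_sleP; exact: subset_trans h1.
  - move=> p; have [e [b ->]] := oriented_edgeP p.
    by rewrite !oriented_edgeN negbK.
  - move=> r s; have [e [b ->]] := oriented_edgeP r;
      have [f [c ->]] := oriented_edgeP s.
    by rewrite !oriented_edgeN => /edge_sleP h; apply/edge_sleP;
      rewrite !vsideN; exact: subsetC.
have unorE e b c : unor (oriented_edge e b) (oriented_edge e c).
  rewrite /unor oriented_edgeN; case: (b); case: (c); by [left|right].
split=> //.
- move=> r s; have [e [b ->]] := oriented_edgeP r;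
    have [f [c ->]] := oriented_edgeP s.
  have [<-|ef] := pselect (e = f).
    exists (oriented_edge e b), (oriented_edge e b); split=> //; left;
      exact: sle_refl.
  have [b' s1] : exists b', side e b' (Vertex (end_vertex f true)).
    by case: (@side_total e true (Vertex (end_vertex f true)));
      [exact: vertex_not_inner|exists true|exists false].
  have [c' s2] : exists c', side f (~~ c') (Vertex (end_vertex e b')).
    by case: (@side_total f true (Vertex (end_vertex e b')));
      [exact: vertex_not_inner|exists false|exists true].
  exists (oriented_edge e b'), (oriented_edge f c'); split=> //; left.
  by apply: edge_sle_or => //; exact: side_ends s1.
- move=> s [r []]; have [e [b ->]] := oriented_edgeP r;
    have [f [c ->]] := oriented_edgeP s.
  rewrite !oriented_edgeN => ne /edge_sleP h1 /edge_sleP h2.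
  case: (@side_neg e b (end_vertex f (~~ c))) => h _.
  have [s1|s1] := pselect (side e b (Vertex (end_vertex f (~~ c)))).
    exact: side_end_neg (h1 _ s1).
  by exact: side_end_neg (h2 _ (h s1)).
Qed.

End TreeLike.

(** * Consistent orientations *)

Section TreeSet.
Variable S : sep_data.
Hypotheses (treeS : tree_set S) (regS : regular S).
Let sepS := tree_set_sep treeS.
Let K := sinvK sepS.
Let tr := sle_trans sepS.
Let an := sle_anti sepS.
Let rv := sinv_rev sepS.
Implicit Types (r s t : S) (O : set S).

Lemma sinv_nsmall s : ~ sle (sinv s) s.
Proof. by move=> h; apply: (regS (s := sinv s)); rewrite /small K. Qed.

Lemma sinv_neq s : sinv s <> s.
Proof. by move=> e; apply: (regS (s := s)); rewrite /small e; exact: sle_refl.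
  Qed.

Lemma unor_sinv s : unor (sinv s) = unor s.
Proof. by rewrite /unor K setUC. Qed.

Lemma unor_eqP r s : unor r = unor s -> r = s \/ r = sinv s.
Proof. by move=> h; have : unor s r by rewrite -h; left. Qed.

Lemma sle_sinv r s : sle (sinv r) (sinv s) -> sle s r.
Proof. by move=> /rv; rewrite !K. Qed.

Lemma sle_sinvl r s : sle (sinv r) s -> sle (sinv s) r.
Proof. by move=> /rv; rewrite K. Qed.

Lemma sle_sinvr r s : sle r (sinv s) -> sle s (sinv r).
Proof. by move=> /rv; rewrite K. Qed.

Lemma nested_cases s t :
  [\/ sle s t, sle t s, sle s (sinv t) | sle (sinv t) s].
Proof.
have [s' [t' [ss tt cmp]]] := tree_set_nested treeS s t.
case: ss tt cmp => -> [] -> [].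
- exact: Or41.
- exact: Or42.
- exact: Or43.
- exact: Or44.
- by move=> /sle_sinvl; exact: Or44.
- by move=> /sle_sinvr; exact: Or43.
- by move=> /sle_sinv; exact: Or42.
- by move=> /sle_sinv; exact: Or41.
Qed.

Lemma nontrivial_eq s t : sle s t -> sle s (sinv t) -> t = s \/ t = sinv s.
Proof.
move=> h1 h2; apply: unor_eqP; apply: contrapT => ne.
by apply: (tree_set_nontrivial treeS (s := s)); exists t.
Qed.

Lemma orientation_total O s : orientation O -> O s \/ O (sinv s).
Proof. by move=> orO; have [w [[[->|->] ?] _]] := orO s; [left|right]. Qed.

Lemma orientation_excl O s : orientation O -> O s -> O (sinv s) -> False.
Proof.
move=> orO a b; have [w [_ w1]] := orO s; apply: (@sinv_neq s).
by transitivity w; [symmetry|]; apply: w1; split=> //; [right|left].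
Qed.

Lemma orientationP O : (forall s, O s \/ O (sinv s)) ->
  (forall s, O s -> O (sinv s) -> False) -> orientation O.
Proof.
move=> tot excl s; case: (tot s) => Os.
  exists s; split; first by split=> //; left.
  by move=> t [[->//|->] /(excl _ Os)].
exists (sinv s); split; first by split=> //; right.
by move=> t [[->|->//]] /excl/(_ Os).
Qed.

Lemma consistent_contra O s t : consistent_orientation O ->
  O s -> O t -> sle (sinv s) t -> False.
Proof.
move=> [orO cO] Os Ot st; have /unor_eqP[E|E] := cO _ _ Ot Os st.
  by rewrite E in st; exact: sinv_nsmall st.
by rewrite E in Ot; exact: (orientation_excl orO Os).
Qed.

Lemma consistent_down O s t : consistent_orientation O ->
  sle s t -> O t -> O s.
Proof.
move=> cO st Ot; case: (orientation_total s cO.1) => // Os.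
by case: (consistent_contra cO Os Ot); rewrite K.
Qed.

Lemma consistent_orientationP O : orientation O ->
  (forall s t, O s -> O t -> sle (sinv s) t -> False) ->
    consistent_orientation O.
Proof. by move=> orO h; split=> // r s Or Os sr; case: (h _ _ Os Or sr). Qed.

Lemma orientation_eq O O' : orientation O -> orientation O' ->
  O `<=` O' -> O = O'.
Proof.
move=> orO orO' sub; apply/seteqP; split=> // s O's.
by case: (orientation_total s orO) => // /sub /(orientation_excl orO' O's).
Qed.

Local Notation at_ := (orientation_at treeS regS).

Lemma at_consistent s : consistent_orientation (at_ s).
Proof. exact: orientation_at_consistent. Qed.

Lemma at_self s : at_ s s.
Proof. by have [] := orientation_at_maximal treeS regS s. Qed.

Lemma at_sinv s : ~ at_ s (sinv s).
Proof. exact: (orientation_excl (at_consistent s).1 (at_self s)). Qed.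

Lemma at_max s t : at_ s t -> sle s t -> t = s.
Proof. by have [_] := orientation_at_maximal treeS regS s; apply. Qed.

(** Both ends of the edge [t] lie beyond [s]: were [sinv s] in [O(sinv t)], it would be strictly
    above the maximal element [sinv t]. *)
Lemma at_above s t : slt s t -> at_ t s /\ at_ (sinv t) s.
Proof.
move=> [st ne]; split.
  exact: (consistent_down (at_consistent t) st (at_self t)).
case: (orientation_total s (at_consistent (sinv t)).1) => // h.
have := at_max h (rv st) => /(congr1 sinv); rewrite !K => E.
by case: ne.
Qed.

(* [O(t)] lies between any two vertices that [t] separates. *)
Lemma at_between O O' t u : consistent_orientation O ->
  consistent_orientation O' ->
  O t -> O' (sinv t) -> O u -> O' u -> at_ t u.
Proof.
move=> cO cO' Ot O't Ou O'u; case: (nested_cases t u) => h.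
- by have := consistent_down cO' h O'u => /(orientation_excl cO'.1)/(_ O't).
- exact: (consistent_down (at_consistent t) h (at_self t)).
- case: (orientation_total u (at_consistent t).1) => // a.
  have E := at_max a h; rewrite -E in Ot.
  by case: (orientation_excl cO.1 Ou Ot).
- by case: (consistent_contra cO Ou Ot h).
Qed.

(** Apply [at_between] to [u] or to [sinv u]. Replacing one of two vertices by an end of a
    separating edge thus preserves every agreement between them. *)
Lemma at_between_iff O O' t u : consistent_orientation O ->
  consistent_orientation O' ->
  O t -> O' (sinv t) -> (O u <-> O' u) -> (O u <-> at_ t u).
Proof.
move=> cO cO' Ot O't uu'; split=> [Ou|au].
  exact: (at_between cO cO' Ot O't Ou (uu'.1 Ou)).
apply: contrapT => nOu.
have Ou : O (sinv u) by case: (orientation_total u cO.1).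
have O'u : O' (sinv u).
  by case: (orientation_total u cO'.1) => // /uu'.
have := at_between cO cO' Ot O't Ou O'u.
exact: (orientation_excl (at_consistent t).1 au).
Qed.

(** A form of both E^+ and E^- that does not mention [O']: they are [above e] and [above (sinv e)],
    by [EplusE] and [EminusE]. *)
Definition above s : set (ts_edge S) :=
  [set a | exists t, val a = unor t /\ slt s t].

(** If one orientation of [a] were above both [s] and [sinv s], its inverse would be trivial. If
    opposite orientations were, antisymmetry would fail. *)
Lemma above_excl s a : above s a -> above (sinv s) a -> False.
Proof.
move=> [t [E1 [st ne]]] [t' [E2 [st' ne']]].
have /unor_eqP[E|E] : unor t = unor t' by rewrite -E1.
  rewrite {t E1}E in st ne.
  have h1 := rv st; have h2 := rv st'; rewrite K in h2.
  case: (nontrivial_eq h2 h1) => e; first by apply: ne'; rewrite e K.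
  by apply: ne; rewrite e K.
by apply: ne; apply: an => //; rewrite E; exact: sle_sinvl.
Qed.

Lemma above_neq s a : above s a -> val a <> unor s.
Proof.
move=> [t [Et [st ne]]]; rewrite Et => /unor_eqP[E|E]; first by rewrite E in ne.
by rewrite E in st; exact: regS st.
Qed.

Lemma above_total s a : [\/ val a = unor s, above s a | above (sinv s) a].
Proof.
have [t _ E] := set_valP a.
have [e|ne] := pselect (unor t = unor s); first by apply: Or31; rewrite -E.
have h r u : unor r = unor s -> unor u = unor t -> r <> u.
  by move=> rs ut e; apply: ne; rewrite -rs -ut e.
case: (nested_cases s t) => c.
- by apply: Or32; exists t; split=> //; split=> //; exact: h.
- apply: Or33; exists (sinv t); rewrite unor_sinv; split=> //; split;
    first exact: rv.
  by apply: h; rewrite unor_sinv.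
- apply: Or32; exists (sinv t); rewrite unor_sinv; split=> //; split=> //.
  by apply: h => //; rewrite unor_sinv.
- apply: Or33; exists t; split=> //; split; first by exact: sle_sinvl.
  by apply: h => //; rewrite unor_sinv.
Qed.

Lemma above_mono s t a : sle s t -> above t a -> above s a.
Proof.
move=> st [u [E [tu ne]]]; exists u; split=> //; split; first exact: tr tu.
by move=> su; apply: ne; apply: an => //; rewrite -su.
Qed.

Variable O' : set S.
Hypothesis orO' : orientation O'.

Lemma EplusE e : Eplus O' e = above e.
Proof.
apply/seteqP; split=> [a [s [Os E [h|h]]]|a [t [E h]]].
- by exists s.
- by exists (sinv s); rewrite unor_sinv.
- case: (orientation_total t orO') => Ot; first by exists t; split=> //; left.
  by exists (sinv t); rewrite unor_sinv K; split=> //; right.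
Qed.

Lemma slt_sinv r s : slt r s -> slt (sinv s) (sinv r).
Proof. by move=> [rs ne]; split;
  [exact: rv|move/(congr1 sinv); rewrite !K => /esym]. Qed.

Lemma EminusE e : Eminus O' e = above (sinv e).
Proof.
apply/seteqP; split=> [a [s [Os E [/slt_sinv h|/slt_sinv h]]]|a
  [t [E /slt_sinv h]]].
- by exists (sinv s); rewrite unor_sinv.
- by exists s; split=> //; move: h; rewrite K.
- rewrite K in h; case: (orientation_total t orO') => Ot; first by exists t;
    split=> //; right.
  by exists (sinv t); rewrite unor_sinv; split=> //; left.
Qed.

Lemma orientation_unor s t : O' s -> O' t -> unor s = unor t -> s = t.
Proof.
move=> Os Ot /unor_eqP[//|E]; rewrite E in Os.
by case: (orientation_excl orO' Ot Os).
Qed.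

End TreeSet.

(** * The space of a regular tree set *)

Section OpenUnit.
Variable R : realType.
Implicit Types x y z : open_unit R.

Lemma open_unit_gt0 x : 0 < val x. Proof. by have /andP[] := valP x. Qed.

Lemma open_unit_lt1 x : val x < 1. Proof. by have /andP[] := valP x. Qed.

Lemma open_unit_dense (a b : R) : 0 <= a -> a < b -> b <= 1 ->
  exists x, a < val x < b.
Proof.
move=> a0 ab b1; have /andP[h1 h2] : a < (a + b) / 2 < b by rewrite !midf_lt.
have h : 0 < (a + b) / 2 < 1 by rewrite (le_lt_trans a0 h1) (lt_le_trans h2 b1).
by exists (exist (fun x : R => is_true (0 < x < 1)) _ h); rewrite /= h1 h2.
Qed.

Lemma open_unit_above x : exists y, val x < val y.
Proof.
have [||y /andP[]] := @open_unit_dense (val x) 1 _ (open_unit_lt1 x) => //.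
  exact/ltW/open_unit_gt0.
by exists y.
Qed.

Lemma open_unit_below x : exists y, val y < val x.
Proof.
have [||y /andP[_]] := @open_unit_dense 0 (val x) _ (open_unit_gt0 x) => //.
  exact/ltW/open_unit_lt1.
by exists y.
Qed.

Lemma open_unit_between x y : val x < val y -> exists z, val x < val z < val y.
Proof.
by move=> xy; apply: open_unit_dense => //; apply/ltW;
  [exact: open_unit_gt0|exact: open_unit_lt1].
Qed.

End OpenUnit.

Section TreeSpace.
Variables (R : realType) (S : sep_data).
Hypotheses (treeS : tree_set S) (regS : regular S).
Variable O' : set S.
Hypothesis orO' : orientation O'.
Let sepS := tree_set_sep treeS.
Let K := sinvK sepS.
Local Notation G := (tree_space R treeS regS orO').
Local Notation X := (gspace G).
Local Notation rep := (ts_rep treeS orO').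
Local Notation vat := (ts_vertex_at treeS regS).
Local Notation hp := (@half_plus R S O').
Local Notation hm := (@half_minus R S O').
Implicit Types (r x y : open_unit R) (s t e : S) (a : ts_edge S)
  (o : ts_vertex S) (p q : X).

Lemma repO a : O' (rep a).
Proof. by rewrite /ts_rep; case: cid => s []. Qed.

Lemma rep_unor a : unor (rep a) = val a.
Proof. by rewrite /ts_rep; case: cid => s []. Qed.

Lemma rep_eq e a : O' e -> val a = unor e -> rep a = e.
Proof.
by move=> Oe E; apply: (orientation_unor treeS regS orO') => //;
  [exact: repO|rewrite rep_unor].
Qed.

Lemma ts_vertexP o : consistent_orientation (val o).
Proof. exact: set_valP o. Qed.

Lemma vertex_total o s : val o s \/ val o (sinv s).
Proof. by apply: orientation_total; have [] := ts_vertexP o. Qed.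

Lemma vertex_excl o s : val o s -> val o (sinv s) -> False.
Proof. by apply: (orientation_excl treeS regS); have [] := ts_vertexP o. Qed.

Lemma hp_vertex e r o : hp e r (Vertex o) = val o e. Proof. by []. Qed.

Lemma hm_vertex e r o : hm e r (Vertex o) = val o (sinv e). Proof. by []. Qed.

Lemma hp_inner e r x a :
  hp e r (Inner x a) <-> above e a \/ (val a = unor e /\ val r < val x).
Proof. by rewrite /half_plus /= (EplusE treeS orO'). Qed.

Lemma hm_inner e r x a :
  hm e r (Inner x a) <-> above (sinv e) a \/ (val a = unor e /\ val x < val r).
Proof. by rewrite /half_minus /= (EminusE treeS orO'). Qed.

Lemma half_disjoint e r p : hp e r p -> hm e r p -> False.
Proof.
case: p => [ o|x a]; first exact: vertex_excl.
move=> /hp_inner[h|[h h']] /hm_inner[k|[k k']].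
- exact: (above_excl treeS h k).
- exact: (above_neq regS h k).
- by apply: (above_neq regS k); rewrite (unor_sinv treeS).
- by have := lt_trans h' k'; rewrite ltxx.
Qed.

Lemma open_subbase (B : set X) : @ts_subbase R S O' B -> open B.
Proof.
move=> sB; suff : @open (ts_point R O') B by [].
exists [set B]; last by rewrite bigcup_set1.
by move=> _ ->; exact: (finI_from1 id).
Qed.

Lemma open_hp e r : O' e -> open (hp e r : set X).
Proof. by move=> Oe; apply: open_subbase; exists e, r; split=> //; left. Qed.

Lemma open_hm e r : O' e -> open (hm e r : set X).
Proof. by move=> Oe; apply: open_subbase; exists e, r; split=> //; right. Qed.

(** Convergence, and with it continuity, need only be tested on the subbase. *)
Lemma tree_space_cvg (F : set_system X) p : Filter F ->
  (forall e r, O' e -> hp e r p -> F (hp e r)) ->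
  (forall e r, O' e -> hm e r p -> F (hm e r)) -> F --> p.
Proof.
move=> FF h1 h2 A; rewrite nbhsE => -[B [oB Bp] BA].
(* The open sets of [G] are by definition those of [ts_point O'], which unfold to unions of finite
   intersections of subbasic sets. *)
have {}oB : @open (ts_point R O') B by [].
case: oB => D sD DB; move: Bp; rewrite -DB => -[C DC Cp].
apply: (@filterS _ F _ C).
  by move=> z Cz; apply: BA; rewrite -DB; exists C.
have [E sE CE] := sD _ DC; move: Cp; rewrite -CE => Cp.
apply: filter_bigI => B' B'E; have /set_mem sB' := sE _ B'E.
have B'p : B' p by exact: Cp.
by case: sB' B'p => e [r [Oe [->|->]]] ?; [exact: h1|exact: h2].
Qed.

Lemma tree_space_continuous (Y : topologicalType) (f : Y -> X) :
  (forall e r, O' e -> open (f @^-1` hp e r)) ->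
  (forall e r, O' e -> open (f @^-1` hm e r)) -> continuous f.
Proof.
move=> h1 h2 y; apply: tree_space_cvg => e r Oe p;
  by apply: open_nbhs_nbhs; split=> //; first [exact: h1|exact: h2].
Qed.

Lemma above_end e a o : o = vat (rep a) \/ o = vat (sinv (rep a)) ->
  above e a -> val o e.
Proof.
move=> oE [t [E /(at_above treeS regS)[h1 h2]]].
rewrite -rep_unor in E; case: (unor_eqP E) oE => -> [] -> //=.
by rewrite K.
Qed.

(** An edge other than [e] has its ends on the same side of [e] as its inner points. *)
Lemma end_above e a o : o = vat (rep a) \/ o = vat (sinv (rep a)) ->
  val a <> unor e -> (val o e <-> above e a).
Proof.
move=> oE ne; split; last exact: above_end.
by case: (above_total treeS e a) => // /(above_end oE) h /vertex_excl/(_ h).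
Qed.

(** An edge other than [e] lies wholly in one half, while [e] itself is cut at [r]. This holds for
    every real [z] because [edge_iota] is constant outside (0,1), which contains [val r]. *)
Lemma half_iota e r a (z : R) : O' e ->
  (hp e r (edge_iota (a : edge G) z) <->
    above e a \/ (val a = unor e /\ val r < z)) /\
  (hm e r (edge_iota (a : edge G) z) <->
    above (sinv e) a \/ (val a = unor e /\ z < val r)).
Proof.
move=> Oe.
have gen o (C D : Prop) : o = vat (rep a) \/ o = vat (sinv (rep a)) ->
  val a <> unor e ->
    (val o e <-> above e a \/ (val a = unor e /\ C)) /\
    (val o (sinv e) <-> above (sinv e) a \/ (val a = unor e /\ D)).
  move=> oE ne; have ne' : val a <> unor (sinv e) by rewrite (unor_sinv treeS).
  have h1 := end_above oE ne; have h2 := end_above oE ne'.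
  by split; [rewrite h1|rewrite h2]; split;
    [left|case=> // -[/ne]|left|case=> // -[/ne]].
have [z0|z0] := leP z 0; last have [z1|z1] := leP 1 z; last first.
- by have [|t <- ->] := @edge_iota01 _ G a z;
    [rewrite z0|split; [exact: hp_inner|exact: hm_inner]].
- rewrite edge_iota_ge1 // hp_vertex hm_vertex.
  have [E|ne] := pselect (val a = unor e); last first.
    by apply: gen => //; left.
  rewrite /= (rep_eq Oe E); split; split=> h.
  + by right; split=> //; exact: (lt_le_trans (open_unit_lt1 r) z1).
  + exact: at_self.
  + by case: (at_sinv h).
  + case: h => [/(above_neq regS)|[_ h]]; first by rewrite (unor_sinv treeS).
    by have := lt_trans h (open_unit_lt1 r); rewrite ltNge z1.
- rewrite edge_iota_le0 // hp_vertex hm_vertex.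
  have [E|ne] := pselect (val a = unor e); last first.
    by apply: gen => //; right.
  rewrite /= (rep_eq Oe E); split; split=> h.
  + by case: (@at_sinv _ treeS regS (sinv e)); rewrite K.
  + case: h => [/(above_neq regS)//|[_ h]].
    by have := lt_trans (open_unit_gt0 r) h; rewrite ltNge z0.
  + by right; split=> //; exact: (le_lt_trans z0 (open_unit_gt0 r)).
  + exact: at_self.
Qed.

Lemma continuous_iota a : continuous (edge_iota (a : edge G)).
Proof.
(* As [A] and [B] do not depend on [z], the set is everything, [C] or empty. *)
have gen (A : Prop) (B : Prop) (C : set R) : open C ->
  open [set z | A \/ (B /\ C z)].
  move=> oC; have [a'|na] := pselect A.
    rewrite (_ : [set z | _] = setT); first exact: openT.
    by apply/seteqP; split=> // z _; left.
  have [b'|nb] := pselect B.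
    by rewrite (_ : [set z | _] = C) //; apply/seteqP; split=> z;
      [case=> // -[]|right].
  rewrite (_ : [set z | _] = set0); first exact: open0.
  by apply/seteqP; split=> // z [//|[]].
apply: tree_space_continuous => e r Oe.
- rewrite (_ : _ @^-1` _ =
    [set z | above e a \/ (val a = unor e /\ val r < z)]).
    by apply: (gen _ _ [set z | val r < z]); exact: open_gt.
  by apply/seteqP; split=> z /(half_iota r a z Oe).1.
- rewrite (_ : _ @^-1` _ =
    [set z | above (sinv e) a \/ (val a = unor e /\ z < val r)]).
    by apply: (gen _ _ [set z | z < val r]); exact: open_lt.
  by apply/seteqP; split=> z /(half_iota r a z Oe).2.
Qed.

(** Two opposite halves cut at parameters on either side of [z] meet exactly in an open piece of the
    edge. *)
Lemma iota_image_open a (U : set R) : U `<=` `]0, 1[ -> open U ->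
  open (edge_iota (a : edge G) @` U).
Proof.
move=> U01 oU; rewrite openE => _ [z Uz <-].
have [d /= d0 dU] : nbhs z U by exact: open_nbhs_nbhs.
have zd (y : R) : `|z - y| < d -> U y by move=> h; apply: dU.
(* Half the radius keeps the cuts [z - d / 2] and [z + d / 2] inside [U], hence strictly between 0
   and 1 as [open_unit] requires. *)
have d20 : 0 < d / 2 by rewrite divr_gt0.
have d2d : d / 2 < d by rewrite ltr_pdivrMr // mulr_natr mulr2n ltrDl.
have mk (y : R) : `|z - y| < d -> exists t : open_unit R, val t = y.
  by move=> /zd/U01; rewrite /= in_itv /= => h;
    exists (exist (fun x : R => is_true (0 < x < 1)) _ h).
have [lo loE] : exists t : open_unit R, val t = z - d / 2.
  by apply: mk; rewrite opprB addrCA subrr addr0 gtr0_norm.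
have [hi hiE] : exists t : open_unit R, val t = z + d / 2.
  by apply: mk; rewrite opprD addrA subrr add0r normrN gtr0_norm.
exists (hp (rep a) lo `&` hm (rep a) hi); split.
- by apply: openI; [exact: open_hp (repO a)|exact: open_hm (repO a)].
- split; [apply/(half_iota lo a z (repO a)).1|apply/(half_iota hi a z
    (repO a)).2];
    right; rewrite rep_unor; split=> //.
    by rewrite loE ltrBlDr ltrDl.
  by rewrite hiE ltrDl.
- case=> [ o [h1 /(vertex_excl h1)//]|x b [/hp_inner h1 /hm_inner h2]].
  case: h1 => [h1|[h1 l1]].
    case: h2 => [/(above_excl treeS h1)//|[/(above_neq regS h1)//]].
  case: h2 => [/(above_neq regS)|[_ l2]]; first by rewrite (unor_sinv treeS).
  have ba : b = a by apply: val_inj; rewrite /= h1 rep_unor.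
  exists (val x); last by rewrite edge_iota_inner ba.
  apply: zd; rewrite ltr_distlC; rewrite loE in l1; rewrite hiE in l2.
  by rewrite (lt_trans _ l1) ?(lt_trans l2) // ?ltrD2l // ltrN2.
Qed.

Lemma vertex_neq o o' : o <> o' -> exists s, val o s /\ val o' (sinv s).
Proof.
move=> ne; apply: contrapT => h; apply: ne; apply: val_inj.
apply: (orientation_eq treeS regS);
  [exact: (ts_vertexP o).1|exact: (ts_vertexP o').1|].
move=> s os; case: (vertex_total o' s) => // o's.
by case: h; exists s.
Qed.

Definition half_separated p q := exists e r, O' e /\
  ((hp e r p /\ hm e r q) \/ (hm e r p /\ hp e r q)).

Lemma half_separatedC p q : half_separated p q -> half_separated q p.
Proof.
by move=> [e [r [Oe [[h1 h2]|[h1 h2]]]]]; exists e, r; split=> //; [right|left].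
Qed.

Lemma vertex_half_separated o o' r : o <> o' -> exists e, O' e /\
  ((hp e r (Vertex o) /\ hm e r (Vertex o')) \/
   (hm e r (Vertex o) /\ hp e r (Vertex o'))).
Proof.
move=> /vertex_neq[s [os o's]]; case: (orientation_total s orO') => Os.
  by exists s; split=> //; left.
by exists (sinv s); split=> //; right; rewrite hm_vertex K.
Qed.

(** Cut the edge [a] itself: between the two points if [q] is on it, and otherwise just after or
    just before [x], according to the side of [a] that holds [q]. *)
Lemma inner_half_separated x a q : q <> Inner x a ->
  half_separated q (Inner x a).
Proof.
have [y xy] := open_unit_above x; have [w wx] := open_unit_below x.
have hpa r : val r < val x -> hp (rep a) r (Inner x a).
  by move=> h; apply/hp_inner; right; rewrite rep_unor.
have hma r : val x < val r -> hm (rep a) r (Inner x a).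
  by move=> h; apply/hm_inner; right; rewrite rep_unor.
have Oa := repO a.
case: q => [ o|z b] ne.
  case: (vertex_total o (rep a)) => h.
    by exists (rep a), y; split=> //; left; split=> //; exact: hma.
  by exists (rep a), w; split=> //; right; split=> //; exact: hpa.
case: (above_total treeS (rep a) b) => [E|h|h].
- have ba : b = a by apply: val_inj; rewrite /= E rep_unor.
  rewrite {b E}ba in ne *.
  have : val z != val x by apply/eqP => /val_inj E; apply: ne; rewrite E.
  rewrite neq_lt => /orP[] /open_unit_between[r /andP[h1 h2]];
    exists (rep a), r; split=> //.
    by right; split; [apply/hm_inner; right; rewrite rep_unor|exact: hpa].
  by left; split; [apply/hp_inner; right; rewrite rep_unor|exact: hma].
- by exists (rep a), y; split=> //; left; split;
    [apply/hp_inner; left|exact: hma].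
- by exists (rep a), w; split=> //; right; split;
    [apply/hm_inner; left|exact: hpa].
Qed.

Lemma tree_space_hausdorff : hausdorff_space X.
Proof.
rewrite open_hausdorff => p q /eqP pq.
have [e [r [Oe h]]] : half_separated p q.
  case: p q pq => [ o|x a] [ o'|y b] pq.
  - have [|e [Oe h]] := @vertex_half_separated o o' (half_unit R).
      by move=> E; apply: pq; rewrite E.
    by exists e, (half_unit R).
  - exact: inner_half_separated.
  - by apply: half_separatedC; apply: inner_half_separated; exact/nesym.
  - exact: inner_half_separated.
have [oh om] := (open_hp r Oe, open_hm r Oe).
have dis : hp e r `&` hm e r = set0.
  by apply/seteqP; split=> // z [/half_disjoint h' /h'].
case: h => -[h1 h2].
  by exists (hp e r, hm e r); rewrite /= ?inE; split=> //; exact/eqP.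
exists (hm e r, hp e r); rewrite /= ?inE; split=> //.
by rewrite setIC; apply/eqP; rewrite dis.
Qed.

Lemma tree_space_graph_like : graph_like G.
Proof.
split.
- by move=> a; apply: continuous_subspaceT; exact: continuous_iota.
- exact: iota_image_open.
- move=> o o' /(@vertex_half_separated _ _ (half_unit R))[e [Oe h]].
  have [oh om] := (open_hp (half_unit R) Oe, open_hm (half_unit R) Oe).
  have dis : hp e (half_unit R) `&` hm e (half_unit R) = set0.
    by apply/seteqP; split=> // z [/half_disjoint h' /h'].
  have V (z : vertex G) : hp e (half_unit R) (Vertex z) \/ hm e (half_unit R)
    (Vertex z).
    exact: vertex_total.
  case: h => -[h1 h2]; [exists (hp e (half_unit R)), (hm e (half_unit R))|
      exists (hm e (half_unit R)), (hp e (half_unit R))]; split=> //.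
  + by move=> _ [z _ <-]; exact: V.
  + by rewrite setIC.
  + by move=> _ [z _ <-]; case: (V z); [right|left].
- exact: tree_space_hausdorff.
Qed.

End TreeSpace.

(** * T(tau) is tree-like, and its edge tree set is tau *)

Section TreeSpaceTreeLike.
Variables (R : realType) (S : sep_data).
Hypotheses (treeS : tree_set S) (regS : regular S).
Variable O' : set S.
Hypothesis orO' : orientation O'.
Let sepS := tree_set_sep treeS.
Let K := sinvK sepS.
Local Notation G := (tree_space R treeS regS orO').
Local Notation X := (gspace G).
Local Notation rep := (ts_rep treeS orO').
Local Notation vat := (ts_vertex_at treeS regS).
Local Notation hp := (@half_plus R S O').
Local Notation hm := (@half_minus R S O').
Implicit Types (r x y : open_unit R) (s t e : S) (a : ts_edge S)
  (o : ts_vertex S) (p q : X).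
Let glG : graph_like G := @tree_space_graph_like R S treeS regS O' orO'.

(* The paper's S(s,r) without the inner points of [s], hence independent of
   r. *)
Definition beyond s : set X :=
  [set p | match p with Vertex o => val o s | Inner _ a => above s a end].

Lemma beyond_mono s t : sle s t -> beyond t `<=` beyond s.
Proof.
move=> st [ o|x a]; last exact: (above_mono treeS st).
exact: (consistent_down treeS regS (ts_vertexP o) st).
Qed.

Lemma beyond_excl s p : beyond s p -> beyond (sinv s) p -> False.
Proof.
by case: p => [ o|x a]; [exact: (vertex_excl treeS regS)|exact:
  (above_excl treeS)].
Qed.

Lemma beyond_total s a p : val a = unor s -> ~ @inner R G a p ->
  beyond s p \/ beyond (sinv s) p.
Proof.
move=> E; case: p => [ o _|x b h]; first exact: vertex_total.
case: (above_total treeS s b) => [k| |]; [|by left|by right].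
by case: h; exists x => //; congr Inner; apply: val_inj; rewrite /= E k.
Qed.

Lemma beyond_hp e r : beyond e `<=` hp e r.
Proof. by move=> [ o|x a] //= h; apply/(hp_inner treeS orO'); left. Qed.

Lemma beyond_hm e r : beyond (sinv e) `<=` hm e r.
Proof. by move=> [ o|x a] //= h; apply/(hm_inner treeS orO'); left. Qed.

Lemma tree_space_compact : compact [set: X].
Proof.
rewrite compact_ultra => F FU _; have FP := @ultra_proper _ _ FU.
have [[a Fa]|nF] := pselect (exists a, F (@inner R G a)).
  have := @compact_closed_edge _ G glG a; rewrite compact_ultra => /(_ F FU)[].
    by apply: filterS Fa; exact: inner_closed_edge.
  by move=> p [_ ?]; exists p.
have nFa a : F (~` @inner R G a).
  by case: (in_ultra_setVsetC (@inner R G a) FU) => // Fa; case: nF; exists a.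
pose O := [set s | F (beyond s)].
have excl s : O s -> O (sinv s) -> False.
  move=> h1 h2; have [p [/beyond_excl p1 /p1]] :
    exists p, (beyond s `&` beyond (sinv s)) p.
    by apply: (@filter_ex _ F); exact: filterI.
  by [].
have orO : orientation O.
  apply: orientationP => // s; case: (in_ultra_setVsetC (beyond s) FU) => [|h];
    first by left.
  (* [F] contains neither [beyond s] nor the inner points of [s], so it contains the remaining set
     [beyond (sinv s)]. *)
  right; pose a : ts_edge S :=
    exist _ (unor s) (mem_set (ex_intro2 _ _ s I erefl)).
  apply: filterS (filterI h (nFa a)) => p [nb ni].
  by case: (@beyond_total s a p _ ni).
have cO : consistent_orientation O.
  apply: consistent_orientationP => // s t Os Ot st; apply: (excl s Os).
  by apply: filterS Ot; exact: beyond_mono.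
pose o : ts_vertex S := exist _ O (mem_set cO).
exists (Vertex o); split=> //; apply: tree_space_cvg => e r Oe h.
  by apply: filterS h; exact: beyond_hp.
by apply: filterS h; exact: beyond_hm.
Qed.

Lemma tree_space_connected : connected [set: X].
Proof.
apply: connected_closedP; first exact: closedT.
move=> B C cB cC BC TBC; apply: contrapT =>
  /not_orP[/eqP/set0P B0 /eqP/set0P C0].
have disj p : B p -> C p -> False by move=> Bp Cp; have : set0 p by rewrite -BC.
have tot p : B p \/ C p by have : [set: X] p by []; rewrite TBC.
have edgeBC a : closed_edge (a : edge G) `<=` B \/ closed_edge (a : edge G) `<=`
  C.
  apply: connected_subset_closed => //; first exact: connected_closed_edge.
  by move=> p _; exact: tot.
(* Edges do not cross the partition, so each nonempty part contains a vertex. *)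
have vtx (A A' : set X) : (forall p, A p -> A' p -> False) -> (forall a,
    closed_edge (a : edge G) `<=` A \/ closed_edge (a : edge G) `<=` A') ->
    A !=set0 -> exists o, A (Vertex o).
  move=> dis h [[ o|x a] Ap]; first by exists o.
  case: (h a) => k; last by case: (dis _ Ap); apply: k;
    apply: inner_closed_edge; exists x.
  by exists (end_vertex (a : edge G) true); apply: k; exact: end_closed_edge.
have [ o1 B1] := vtx _ _ disj edgeBC B0.
have [ o2 C2] : exists o, C (Vertex o).
  by apply: (vtx C B) => // [p Cp Bp|a];
    [exact: disj Cp|case: (edgeBC a); [right|left]].
(* Both ends of the edge [t] lie in the same part, whichever it is. *)
have same t : C (Vertex (vat t)) \/ B (Vertex (vat (sinv t))).
  pose a : ts_edge S := exist _ (unor t) (mem_set (ex_intro2 _ _ t I erefl)).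
  have h c : [/\ B (Vertex (end_vertex (a : edge G) c)) &
    B (Vertex (end_vertex (a : edge G) (~~ c)))]
    \/ [/\ C (Vertex (end_vertex (a : edge G) c)) &
      C (Vertex (end_vertex (a : edge G) (~~ c)))].
    by case: (edgeBC a) => k; [left|right]; split; apply: k;
      exact: end_closed_edge.
  have /unor_eqP[E|E] : unor (rep a) = unor t by rewrite rep_unor.
    case: (h false) => -[]; rewrite /= E => h1 h2; [by right|by left].
  case: (h false) => -[]; rewrite /= E K => h1 h2; [by right|by left].
(* If [u1] and [u2] disagree on the new [s], let [t] be its orientation in [u1]. Either [O(t)] is in
   [C] and replaces [u2], or [O(sinv t)] is in [B] and replaces [u1]; earlier agreements survive by
   [at_between_iff]. *)
have fin (k : seq S) : exists o1 o2, [/\ B (Vertex o1), C (Vertex o2) &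
    forall s, List.In s k -> (val o1 s <-> val o2 s)].
  elim: k => [|s k [u1 [u2 [Bu Cu agr]]]]; first by exists o1, o2.
  have [e|ne] := pselect (val u1 s <-> val u2 s).
    by exists u1, u2; split=> // t /= [<-//|]; exact: agr.
  have [t [ts t1 t2]] : exists t,
    [/\ t = s \/ t = sinv s, val u1 t & val u2 (sinv t)].
    case: (vertex_total u1 s) (vertex_total u2 s) => h1 [h2|h2].
    - by case: ne.
    - by exists s; split=> //; left.
    - by exists (sinv s); rewrite K; split=> //; right.
    - by case: ne; split=> h;
        [case: (vertex_excl treeS regS h h1)|case:
          (vertex_excl treeS regS h h2)].
  have flip o o' w : w = s \/ w = sinv s -> val o w -> val o' w ->
    (val o s <-> val o' s).
    case=> -> // h h'; split=> l;
      [case: (vertex_excl treeS regS l h)|case: (vertex_excl treeS regS l h')].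
  case: (same t) => h.
    exists u1, (vat t); split=> // w /= [<-|/agr wk].
      by apply: (flip u1 (vat t) t) => //; exact: at_self.
    exact: (at_between_iff treeS regS (ts_vertexP u1) (ts_vertexP u2)).
  exists (vat (sinv t)), u2; split=> // w /= [<-|/agr wk].
    apply: (flip (vat (sinv t)) u2 (sinv t)) => //; last exact: at_self.
    by case: ts => ->; [right|left; rewrite K].
  apply: iff_sym; apply: (at_between_iff treeS regS (ts_vertexP u2)
    (ts_vertexP u1)) => //.
    by rewrite K.
  by split=> /wk.
pose h := half_unit R.
(* These closed sets of pairs demand a vertex of [B] with a vertex of [C], and that no [e] in [O']
   separates the two. A common point would be a pair of equal vertices in disjoint parts. *)
pose D (i : option {e | O' e}) : set (X * X) := if i is Some e then
    ~` ((fst @^-1` hp (proj1_sig e) h `&` snd @^-1` hm (proj1_sig e) h) `|`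
        (fst @^-1` hm (proj1_sig e) h `&` snd @^-1` hp (proj1_sig e) h))
  else (fst @^-1` (B `&` @vertices R G)) `&` (snd @^-1` (C `&` @vertices R G)).
have cfst : continuous (@fst X X) by move=> z; exact: cvg_fst.
have csnd : continuous (@snd X X) by move=> z; exact: cvg_snd.
have [||| [p q] pq] := @compact_common_point (X * X)%type _ D.
- by rewrite -setXTT; apply: compact_setX; exact: tree_space_compact.
- case=> [[e Oe]|] /=.
    have oh : open (hp e h : set X) by exact: open_hp.
    have om : open (hm e h : set X) by exact: open_hm.
    by apply: open_closedC; apply: openU; apply: openI;
      by [apply: ((continuousP _).1 cfst)|apply: ((continuousP _).1 csnd)].
  apply: closedI; [apply: ((continuous_closedP _).1 cfst)|
    apply: ((continuous_closedP _).1 csnd)]; apply: closedI => //;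
    exact: closed_vertices.
- move=> l; have [u1 [u2 [Bu Cu agr]]] :=
    fin [seq proj1_sig i | i <- pmap id l].
  exists (Vertex u1, Vertex u2) => -[e|] il; last first.
    by split=> /=; split=> //; [exists u1|exists u2].
  have /agr uu : List.In (proj1_sig e) [seq proj1_sig i | i <- pmap id l].
    elim: l il {agr} => [//|[f|] l IH]; rewrite /=; last by case=> // /IH.
    by case=> [[->]|/IH ?]; [left|right].
  case=> -[/= h1 h2]; first exact: (vertex_excl treeS regS (uu.1 h1) h2).
  exact: (vertex_excl treeS regS (uu.2 h2) h1).
have := pq None; case=> /= -[Bp [v1 _ v1p]] [Cq [v2 _ v2q]].
have [v12|v12] := pselect (v1 = v2).
  by apply: (disj p) => //; rewrite -v1p v12 v2q.
have [e [Oe sep]] := vertex_half_separated treeS regS orO' h v12.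
by apply: (pq (Some (exist _ e Oe))); rewrite /= -v1p -v2q.
Qed.

(** What remains after deleting the open edge and the opposite open half is [beyond s]. Hence
    deleting an edge leaves two disjoint closed parts, as [tree_like_cut] demands. *)
Lemma closed_beyond a s : val a = unor s -> closed (beyond s).
Proof.
move=> E.
have cb e r : O' e -> val a = unor e ->
  closed (beyond e) /\ closed (beyond (sinv e)).
  move=> Oe Ee; have ci := @closed_setC_inner _ G glG a.
  have ni t : unor t = val a -> beyond t `<=` ~` @inner R G a.
    move=> ta [ o _ []//|x b] /= tb /inner_edge_inj ab.
    by apply: (above_neq regS tb); rewrite -ab ta.
  split.
    rewrite (_ : beyond e = ~` @inner R G a `&` ~` hm e r).
      by apply: closedI => //; apply: open_closedC; exact: open_hm.
    apply/seteqP; split=> p;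
      last by case=> /(beyond_total Ee)[//|/beyond_hm h /(_ (h _))].
    move=> ep; split; first by apply: (ni e).
    by move/beyond_hp: ep => /(_ r)/half_disjoint.
  rewrite (_ : beyond (sinv e) = ~` @inner R G a `&` ~` hp e r).
    by apply: closedI => //; apply: open_closedC; exact: open_hp.
  apply/seteqP; split=> p;
    last by case=> /(beyond_total Ee)[/beyond_hp h /(_ (h _))|//].
  move=> ep; split; first by apply: (ni (sinv e)) => //;
    rewrite (unor_sinv treeS).
  by move/beyond_hm: ep => /(_ r) h /half_disjoint h'; exact: h' h.
case: (orientation_total s orO') => Os;
  first by case: (cb s (half_unit R) Os E).
have [] := cb (sinv s) (half_unit R) Os; first by rewrite (unor_sinv treeS).
by rewrite K.
Qed.

Lemma tree_space_tree_like : tree_like G.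
Proof.
split.
(* Over an empty tree set, the empty orientation is still a vertex. *)
- have [[s]|nS] := pselect (exists s : S, True);
    first by exists (Vertex (vat s)).
  have c0 : consistent_orientation (@set0 S).
    by split=> [s|]; [case: nS; exists s|move=> s].
  by exists (Vertex (exist _ (@set0 S) (mem_set c0) : ts_vertex S)).
- exact: glG.
- exact: tree_space_compact.
- move=> a /(congr1 val) /= E; apply: (@at_sinv _ treeS regS (rep a)).
  by rewrite -E; exact: at_self.
- exact: tree_space_connected.
- move=> a conn; have E : val (a : ts_edge S) = unor (rep a) by
    rewrite rep_unor.
  have [|||h|h] := connected_subset_closed conn (closed_beyond E)
      (@closed_beyond a (sinv (rep a)) _) => //.
  + by rewrite (unor_sinv treeS).
  + by apply/seteqP; split=> // p [/beyond_excl h /h].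
  + by move=> p; exact: beyond_total.
  + have := h (Vertex (vat (sinv (rep a)))) (@vertex_not_inner _ G a _).
    by rewrite /= -[X in orientation_at _ _ _ X]K; exact: at_sinv.
  + have := h (Vertex (vat (rep a))) (@vertex_not_inner _ G a _).
    exact: at_sinv.
Qed.

Let tlG := tree_space_tree_like.

(* The orientation of the edge [a] that points to its end-vertex [b]. *)
Definition oriented_rep a (b : bool) : S := if b then rep a else sinv (rep a).

Lemma oriented_repN a b : oriented_rep a (~~ b) = sinv (oriented_rep a b).
Proof. by case: b; rewrite /= ?K. Qed.

Lemma unor_oriented_rep a b : unor (oriented_rep a b) = val a.
Proof. by case: b; rewrite /= ?(unor_sinv treeS) rep_unor. Qed.

Lemma oriented_rep_ex s : exists a b, oriented_rep a b = s.
Proof.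
pose a : ts_edge S := exist _ (unor s) (mem_set (ex_intro2 _ _ s I erefl)).
have /unor_eqP[E|E] : unor (rep a) = unor s by rewrite rep_unor.
  by exists a, true.
by exists a, false; rewrite /= E K.
Qed.

Lemma oriented_rep_inj a b c d : oriented_rep a b = oriented_rep c d ->
  a = c /\ b = d.
Proof.
move=> E; have ac : a = c.
  by apply: val_inj; rewrite -(unor_oriented_rep a b) E unor_oriented_rep.
split=> //; rewrite ac in E; case: b d E => -[] //= E.
  by case: (@sinv_neq _ treeS regS (rep c)).
by case: (@sinv_neq _ treeS regS (rep c)).
Qed.

(** Each side is connected, so it stays in the closed set [beyond] that contains its end. Since the
    two sides cover all vertices, the inclusions are equalities on vertices. *)
Lemma tree_space_side a b :
  vside (a : edge G) b = [set o | val o (oriented_rep a b)].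
Proof.
have sub c : side (a : edge G) c `<=` beyond (oriented_rep a c).
  have E d : val a = unor (oriented_rep a d) by rewrite unor_oriented_rep.
  have [||h|h] := connected_subset_closed (@connected_side _ G a c)
      (closed_beyond (E c)) (closed_beyond (E (~~ c))) => //.
  - by apply/seteqP; split=> // p [];
      rewrite oriented_repN => /beyond_excl h /h.
  - by move=> p /side_sub; rewrite oriented_repN; exact: beyond_total.
  - exfalso; have := h _ (@side_end _ G a c); rewrite oriented_repN.
    by case: (c); rewrite /= ?K;
      [exact: at_sinv|rewrite -{2}(K (rep a)); exact: at_sinv].
apply/seteqP; split=> o; first by move=> /sub.
move=> h; case: (@side_total _ _ tlG a b (Vertex o)) => //;
  first exact: vertex_not_inner.
by move/sub; rewrite oriented_repN => /(vertex_excl treeS regS h).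
Qed.

(** For the converse, the vertices [O(t)] and [O(sinv s)] settle the other three ways in which [s]
    and [t] can be nested. *)
Lemma sle_vertices s t : sle s t <-> forall o, val o t -> val o s.
Proof.
split=> [st o|h]; first exact: (consistent_down treeS regS (ts_vertexP o) st).
have h1 := h (vat t) (at_self treeS regS t).
case: (nested_cases treeS s t) => // k.
- by rewrite -(at_max h1 k); exact: (sle_refl sepS).
- have := consistent_down treeS regS (at_consistent treeS regS (sinv s))
    (sle_sinvr treeS k) (at_self treeS regS (sinv s)).
  by move=> /(h (vat (sinv s))) hs; case: (@at_sinv _ treeS regS (sinv s));
    rewrite K.
- case: (consistent_contra treeS regS (at_consistent treeS regS t)
    (at_self treeS regS t) h1 k).
Qed.

Lemma oriented_rep_sle a b c d : sle (oriented_rep a b) (oriented_rep c d) <->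
  sle (oriented_edge (a : edge G) b) (oriented_edge (c : edge G) d).
Proof.
by rewrite (edge_sleP tlG) !tree_space_side sle_vertices.
Qed.

(** Both systems are parametrised bijectively by an edge and a boolean, and [oriented_rep_sle]
    compares the orders in these coordinates. *)
Lemma tree_space_iso : sep_iso S (edge_tree_set G).
Proof.
have fP s : exists ab : edge G * bool, oriented_rep ab.1 ab.2 = s.
  by have [a [b E]] := oriented_rep_ex s; exists (a, b).
have gP (p : edge_tree_set G) : exists ab :
  edge G * bool, p = oriented_edge ab.1 ab.2.
  by have [a [b E]] := oriented_edgeP p; exists (a, b).
pose f s := let ab := projT1 (cid (fP s)) in oriented_edge ab.1 ab.2.
pose g (p : edge_tree_set G) := let ab :=
  projT1 (cid (gP p)) in oriented_rep ab.1 ab.2.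
have fE (a : edge G) b : f (oriented_rep a b) = oriented_edge a b.
  by rewrite /f; case: cid => -[c d] /= /oriented_rep_inj[-> ->].
have gE (a : edge G) b : g (oriented_edge a b) = oriented_rep a b.
  by rewrite /g; case: cid => -[c d] /= /(oriented_edge_inj tlG)[-> ->].
exists f, g; split.
- by move=> s; have [a [b <-]] := oriented_rep_ex s; rewrite fE gE.
- by move=> p; have [a [b ->]] := oriented_edgeP p; rewrite gE fE.
- move=> r s; have [a [b <-]] := oriented_rep_ex r;
    have [c [d <-]] := oriented_rep_ex s.
  by rewrite !fE => /oriented_rep_sle.
- move=> p q; have [a [b ->]] := oriented_edgeP p;
    have [c [d ->]] := oriented_edgeP q.
  by rewrite !gE => /oriented_rep_sle.
- split=> [s|p].
    by have [a [b <-]] := oriented_rep_ex s;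
      rewrite -oriented_repN !fE oriented_edgeN.
  by have [a [b ->]] := oriented_edgeP p;
    rewrite oriented_edgeN !gE oriented_repN.
Qed.

End TreeSpaceTreeLike.

(** * The space of the edge tree set *)

Section TreeLikeIso.
Variables (R : realType) (G : graph_space R).
Hypothesis tlG : tree_like G.
Let glG := tree_like_graph_like tlG.
Let hG := graph_like_hausdorff glG.
Let cG := tree_like_compact tlG.
Local Notation X := (gspace G).
Local Notation S := (edge_tree_set G).
Let treeS : tree_set S := edge_tree_set_tree_set tlG.
Let regS : regular S := edge_regular tlG.
Implicit Types (e f : edge G) (b c : bool) (u v w : vertex G) (z : X).

Definition pointing v : set S :=
  [set p | exists e b, p = oriented_edge e b /\ side e b (Vertex v)].

Lemma pointingE v e b : pointing v (oriented_edge e b) <-> side e b (Vertex v).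
Proof.
split=> [[f [c [/(oriented_edge_inj tlG)[-> ->]]]] //|h].
by exists e, b.
Qed.

Lemma pointing_consistent v : consistent_orientation (pointing v).
Proof.
apply: consistent_orientationP.
  apply: orientationP => p; have [e [b ->]] := oriented_edgeP p;
      rewrite oriented_edgeN !pointingE.
    by apply: (side_total tlG); exact: vertex_not_inner.
  exact: (side_excl tlG).
move=> p q; have [e [b ->]] := oriented_edgeP p;
  have [f [c ->]] := oriented_edgeP q.
rewrite oriented_edgeN !pointingE => se sf /(edge_sleP tlG) h.
exact: (side_excl tlG se (h _ sf)).
Qed.

Definition vertex_map v : ts_vertex S :=
  exist _ (pointing v) (mem_set (pointing_consistent v)).

(** If no edge separated [u] from [v], their arc would consist of vertices only, and the open sets
    that separate the two vertices would disconnect it. *)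
Lemma vertex_map_inj : injective vertex_map.
Proof.
move=> u v /(congr1 val) /= E; apply: contrapT => uv.
have [U [U' [oU oU' UU' VU [Uu U'v]]]] := vertices_separated glG uv.
have sUU' := open_separated oU oU' UU'.
have [|h|h] := connected_subset sUU' _ (@connected_arc _ _ tlG u v).
- move=> [w _|t e az]; first by apply: VU; exists w.
  have iz : inner e (Inner t e) by exists t.
  have [b su] : exists b, side e b (Vertex u).
    by case: (@side_total _ _ tlG e true (Vertex u));
      [exact: vertex_not_inner|exists true|exists false].
  have sv := arc_inner tlG az iz su; exfalso; apply: (side_excl tlG _ sv).
  by apply/pointingE; rewrite -E; apply/pointingE.
- have : set0 (Vertex v : X) by rewrite -UU'; split=> //; apply: h; exact: arcr.
  by [].
- have : set0 (Vertex u : X) by rewrite -UU'; split=> //; apply: h; exact: arcl.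
  by [].
Qed.

(* Helly property: finitely many sides picked by a consistent orientation
   share the head of one of them. *)
Lemma orientation_list_head (O : set S)
  (l : seq {p : edge G * bool | O (oriented_edge p.1 p.2)}) :
  consistent_orientation O -> l <> [::] ->
  exists w, forall i, List.In i l ->
    side (proj1_sig i).1 (proj1_sig i).2 (Vertex w).
Proof.
move=> cO; elim: l => [//|[[f c] /= Of] l IH] _.
have [->|/IH [w hw]] := pselect (l = [::]).
  by exists (end_vertex f c) => i /= [<-|//]; exact: side_end.
have [sw|nsw] := pselect (side f c (Vertex w)).
  by exists w => i /= [<-//|]; exact: hw.
(* When [w] misses the new side, the new head takes over: a chosen [side e b] that missed it would
   either put [w] in the new side after all or contradict consistency. *)
exists (end_vertex f c) => -[[e b] Oe] /= [[<- <-]|/hw /= sw];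
  first exact: side_end.
apply: contrapT => /(side_neg tlG) ns.
have [E|ef] := pselect (e = f).
  rewrite E in Oe sw ns *; case: (b =P c) => [bc|/eqP bc].
    by rewrite bc in sw.
  have bc' : b = ~~ c by case: (b) (c) bc => -[].
  rewrite bc' -oriented_edgeN in Oe.
  exact: (orientation_excl treeS regS cO.1 Of Oe).
have [k|/(side_neg tlG) k] := pselect (side f c (Vertex (end_vertex e b))).
  by apply: nsw; apply: (side_sub_vside tlG (nesym ef) k ns sw).
apply: (consistent_contra treeS regS cO Oe Of); rewrite oriented_edgeN.
apply: (edge_sle_or tlG ef ns).
by apply: (side_ends tlG (c := b)) => //; exact/nesym.
Qed.

(** By compactness the sides chosen by [o] have a common point. It is a vertex, since an inner point
    of [e] lies on neither side of [e]. *)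
Lemma vertex_map_surj (o : ts_vertex S) : exists v, vertex_map v = o.
Proof.
have cO : consistent_orientation (val o) by exact: set_valP.
have [||z hz] := @compact_common_point X
  {p : edge G * bool | val o (oriented_edge p.1 p.2)}
  (fun i => side (proj1_sig i).1 (proj1_sig i).2) cG.
- by move=> i; exact: closed_side.
- move=> l; have [->|/(orientation_list_head cO)[w hw]] := pselect (l = [::]).
    by have [z _] := tree_like_nonempty tlG; exists z.
  by exists (Vertex w).
have hz' e b : val o (oriented_edge e b) -> side e b z.
  by move=> h; exact: (hz (exist _ (e, b) h)).
case: z hz' {hz} => [v|t e] hz.
  exists v; apply: val_inj => /=; symmetry.
  apply: (orientation_eq treeS regS cO.1 (pointing_consistent v).1) => p.
  by have [e [b ->]] := oriented_edgeP p => /hz /pointingE.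
have [b /hz/side_sub[]] : exists b, val o (oriented_edge e b).
  case: (orientation_total (oriented_edge e true) cO.1); first by exists true.
  by rewrite oriented_edgeN; exists false.
by exists t.
Qed.

Definition edge_map e : ts_edge S :=
  exist _ (unor (oriented_edge e true)) (mem_set (ex_intro2 _ _ _ I erefl)).

Lemma unor_edge_map e b : unor (oriented_edge e b) = val (edge_map e).
Proof.
case: b => //=; rewrite -(unor_sinv treeS) oriented_edgeN //.
Qed.

Lemma edge_map_inj : injective edge_map.
Proof.
move=> e f E.
have /unor_eqP[] : unor (oriented_edge e true) = unor (oriented_edge f true).
- exact: (congr1 val E).
- by move=> /(oriented_edge_inj tlG)[].
- by rewrite oriented_edgeN => /(oriented_edge_inj tlG)[].
Qed.

Lemma edge_map_surj (a : ts_edge S) : exists e, edge_map e = a.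
Proof.
have [p _ E] := set_valP a; have [e [b pE]] := oriented_edgeP p.
by exists e; apply: val_inj; rewrite -(unor_edge_map e b) -pE.
Qed.

(** Identifies the edges above an oriented edge in tau(T) with those inside its side in T, so that
    the two topologies can be compared. *)
Lemma above_edge_map e b f (t : open_unit R) :
  above (oriented_edge e b) (edge_map f) <-> side e b (Inner t f).
Proof.
have fin : inner f (Inner t f) by exists t.
split.
  move=> [q [E [/= lt ne]]]; have [g [d qE]] := oriented_edgeP q.
  have fg : f = g by apply: edge_map_inj; apply: val_inj;
    rewrite E qE unor_edge_map.
  rewrite qE -fg in lt ne; move/(edge_sleP tlG): lt => sub.
  have sd := sub _ (@side_end _ G f d).
  apply: (side_edge tlG _ (@end_closed_edge _ G f d) _ sd);
    last exact: inner_closed_edge.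
  move=> ef; rewrite -ef in sd ne; apply: ne; congr oriented_edge.
  apply/eqP; apply: contrapT => /negP bd; apply: (@side_end_neg _ _ tlG e b).
  by rewrite (_ : ~~ b = d) //; case: (b) (d) bd => -[].
move=> st; have ef : e <> f by move=> E; case: (side_sub st); rewrite E.
have sf c : side e b (Vertex (end_vertex f c)).
  by apply: (side_edge tlG ef _ _ st);
    [exact: inner_closed_edge|exact: end_closed_edge].
have [d sd] : exists d, side f (~~ d) (Vertex (end_vertex e b)).
  by case: (@side_total _ _ tlG f true (Vertex (end_vertex e b)));
    [exact: vertex_not_inner|exists false|exists true].
exists (oriented_edge f d); rewrite unor_edge_map; split=> //; split.
  exact: (edge_sle_or tlG ef (sf d) sd).
by move=> /(oriented_edge_inj tlG)[].
Qed.

(** * The homeomorphism from T to T(tau(T)) *)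

Lemma flip_subproof (t : open_unit R) : 0 < 1 - val t < 1.
Proof. by rewrite subr_gt0 open_unit_lt1 ltrBlDr ltrDl open_unit_gt0. Qed.

Definition flip (t : open_unit R) : open_unit R :=
  exist (fun x : R => is_true (0 < x < 1)) _ (flip_subproof t).

Lemma flipK : involutive flip.
Proof. by move=> t; apply: val_inj; rewrite /= subKr. Qed.

(** Where [O'] orients an edge against its parametrisation in [G], inner points must be
    reflected. *)
Definition flip_if b (t : open_unit R) := if b then t else flip t.

Lemma flip_ifK b : involutive (flip_if b).
Proof. by case: b => // t; rewrite /= flipK. Qed.

(** The counterpart in [G] of the subbasic sets: a side with the adjoining piece of its edge, up to
    the cut [q]. *)
Definition half_edge e c (q : open_unit R) : set X :=
  [set z | side e c z \/ exists2 t : open_unit R, z = Inner t e &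
     if c then val q < val t else val t < val q].

Lemma open_half_edge e c q : open (half_edge e c q).
Proof.
(* The closed segment from the opposite end up to and including the cut; together with the opposite
   side it is the complement of [half_edge e c q]. *)
pose J : set R := if c then [set` `[0, val q]] else [set` `[val q, 1]].
have [q0 q1] := (open_unit_gt0 q, open_unit_lt1 q).
have J01 : J `<=` `[0, 1].
  move=> x; rewrite /J; case: (c); rewrite /= !in_itv /= => /andP[h1 h2].
    by rewrite h1 (le_trans h2 (ltW q1)).
  by rewrite h2 (le_trans (ltW q0) h1).
have cJ : closed (edge_iota e @` J).
  apply: (compact_closed hG); apply: continuous_compact.
    by apply: continuous_subspaceW J01 _; exact: iota_continuous.
  by rewrite /J; case: (c); exact: segment_compact.
rewrite (_ : half_edge e c q = ~` side e (~~ c) `&` ~` (edge_iota e @` J)).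
  by apply: openI; apply: closed_openC => //; exact: closed_side.
apply/seteqP; split=> z.
  move=> [sz|[t -> h]].
    split; first exact: (side_excl tlG sz).
    move=> [x Jx xz]; have := J01 _ Jx; rewrite /= in_itv /= => /andP[].
    rewrite le_eqVlt => /orP[/eqP x0 _|x0].
      move: xz Jx; rewrite -x0 edge_iota_le0 // => zE.
      rewrite -zE in sz; rewrite /J; case: c sz {J J01 cJ} => sz.
        by move=> _; exact: (@side_end_neg _ _ tlG e true sz).
      by rewrite /= in_itv /= leNgt q0.
    rewrite le_eqVlt => /orP[/eqP x1|x1].
      move: xz Jx; rewrite x1 edge_iota_ge1 // => zE.
      rewrite -zE in sz; rewrite /J; case: c sz {J J01 cJ} => sz.
        by rewrite /= in_itv /= => /andP[_]; rewrite leNgt q1.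
      by move=> _; exact: (@side_end_neg _ _ tlG e false sz).
    have [|t _ tE] := @edge_iota01 _ G e x; first by rewrite x0.
    by apply: (side_sub sz); rewrite -xz tE; exists t.
  split; first by move=> /side_sub; apply; exists t.
  move=> [x Jx xz]; have x01 : 0 < x < 1.
    have := J01 _ Jx; rewrite /= in_itv /= => /andP[h0 h1].
    rewrite !lt_neqAle h0 h1 !andbT; apply/andP; split; apply/eqP => xE;
      move: xz.
      by rewrite -xE edge_iota_le0.
    by rewrite xE edge_iota_ge1.
  have [t' t'x E] := @edge_iota01 _ G e x x01.
  move: xz; rewrite E => -[tt]; rewrite tt in t'x.
  move: Jx; rewrite /J -t'x; case: (c) h; rewrite /= in_itv /= => h.
    by rewrite [val t <= _]leNgt h andbF.
  by rewrite [val q <= _]leNgt h.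
move=> [ns nJ]; have [ez|ez] := pselect (inner e z); last first.
  by left; case: (@side_total _ _ tlG e c z).
case: ez nJ ns => t _ <- nJ _; right; exists t => //.
have [t0 t1] := (open_unit_gt0 t, open_unit_lt1 t).
case: ifP => cE; rewrite ltNge; apply/negP => h; apply: nJ; exists (val t);
  rewrite ?edge_iota_inner // /J cE /= in_itv /= h ?andbT ltW //.
Qed.

Variables (treeT : tree_set S) (regT : regular S).
Variable O' : set S.
Hypothesis orO' : orientation O'.
Local Notation H := (tree_space R treeT regT orO').
Local Notation rep := (ts_rep treeT orO').

Lemma direction_ex e : exists b, rep (edge_map e) = oriented_edge e b.
Proof.
have /unor_eqP[E|E] : unor (rep (edge_map e)) = unor (oriented_edge e true).
- by rewrite rep_unor.
- by exists true.
- by exists false; rewrite E oriented_edgeN.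
Qed.

Definition direction e : bool := projT1 (cid (direction_ex e)).

Lemma directionE e b : O' (oriented_edge e b) -> direction e = b.
Proof.
move=> Oe; rewrite /direction; case: cid => c /= E.
by move: E; rewrite (rep_eq treeT regT orO' Oe) ?unor_edge_map // =>
  /(oriented_edge_inj tlG)[].
Qed.

Definition point_map (z : X) : gspace H :=
  match z with
  | Vertex v => Vertex (vertex_map v)
  | Inner t e => Inner (flip_if (direction e) t) (edge_map e)
  end.

Lemma point_map_inj : injective point_map.
Proof.
move=> [u|s e] [v|t f] //= E.
  by have := congr1 (fun y => if y is Vertex o then o else vertex_map u) E
    => /vertex_map_inj ->.
have := congr1 (fun y => if y is Inner _ a then a else edge_map e) E.
move=> /edge_map_inj ef; rewrite -ef in E *.
have := congr1 (fun y => if y is Inner x _ then x else s) E.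
by move=> /(can_inj (flip_ifK _)) ->.
Qed.

Lemma point_map_surj (y : gspace H) : exists z, point_map z = y.
Proof.
case: y => [ o|t a].
  by have [v <-] := vertex_map_surj o; exists (Vertex v).
have [e <-] := edge_map_surj a.
by exists (Inner (flip_if (direction e) t) e); rewrite /= flip_ifK.
Qed.

Lemma point_map_continuous : continuous point_map.
Proof.
apply: tree_space_continuous => p r; have [e [b ->]] := oriented_edgeP p => Oe.
  (* As [O'] contains [oriented_edge e b], the direction of [e] is [b], and the cut is reflected
     together with the points. *)
  rewrite (_ : _ @^-1` _ = half_edge e b (flip_if b r));
    first exact: open_half_edge.
  apply/seteqP; split=> -[v|t f].
  - by move=> /pointingE; left.
  - rewrite /preimage /= => /(hp_inner treeT orO')[/(above_edge_map _ _ _ t)|];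
      first by left.
    rewrite unor_edge_map => -[/val_inj/edge_map_inj -> h]; right;
      exists t => //.
    by move: h; rewrite (directionE Oe); case: (b) => //=;
      rewrite ltrBrDr addrC -ltrBrDr.
  - by case=> [|[]//]; move=> /pointingE.
  - move=> h; apply/(hp_inner treeT orO');
      case: h => [/above_edge_map|[s [-> ->] h]]; first by left.
    right; rewrite unor_edge_map; split=> //.
    by move: h; rewrite (directionE Oe); case: (b) => //=;
      rewrite ltrBrDr addrC -ltrBrDr.
rewrite (_ : _ @^-1` _ = half_edge e (~~ b) (flip_if b r));
  first exact: open_half_edge.
apply/seteqP; split=> -[v|t f].
- by move=> h; left; apply/pointingE; rewrite -oriented_edgeN.
- rewrite /preimage /= => /(hm_inner treeT orO'); rewrite oriented_edgeN.
  case=> [/(above_edge_map _ _ _ t)|]; first by left.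
  rewrite unor_edge_map => -[/val_inj/edge_map_inj -> h]; right; exists t => //.
  by move: h; rewrite (directionE Oe); case: (b) => //=;
    rewrite ltrBlDr addrC -ltrBlDr.
- by case=> [/pointingE|[]//]; rewrite -oriented_edgeN.
- move=> h; apply/(hm_inner treeT orO'); rewrite oriented_edgeN.
  case: h => [/above_edge_map|[s [-> ->] h]]; first by left.
  right; rewrite unor_edge_map; split=> //.
  by move: h; rewrite (directionE Oe); case: (b) => //=;
    rewrite ltrBlDr addrC -ltrBlDr.
Qed.

Lemma tree_like_iso : graph_like_iso G H.
Proof.
pose g (y : gspace H) : X := projT1 (cid (point_map_surj y)).
have fg : cancel g point_map by move=> y; rewrite /g; case: cid.
have gf : cancel point_map g by move=> z; apply: point_map_inj; rewrite fg.
exists point_map, g; split=> //.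
- exact: point_map_continuous.
- apply/continuous_closedP => A cA.
  (* The image of a closed set is compact, hence closed in the Hausdorff target. *)
  rewrite (_ : g @^-1` A = point_map @` A).
    apply: compact_closed; first exact: tree_space_hausdorff.
    apply: continuous_compact; last exact: (subclosed_compact cA cG).
    by apply: continuous_subspaceT; exact: point_map_continuous.
  by apply/seteqP; split=> [y Ay|_ [z Az <-]];
    [exists (g y)|rewrite /preimage /= gf].
- apply/seteqP; split=> [_ [_ [v _ <-] <-]|_ [ o _ <-]];
    first by exists (vertex_map v).
  by have [v <-] := vertex_map_surj o; exists (Vertex v) => //; exists v.
Qed.

End TreeLikeIso.

(** * Invariance of regularity, and the correspondence between tree sets and tree-like spaces *)

Lemma orientation_ex (S : sep_data) : tree_set S -> regular S ->
  exists O : set S, orientation O.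
Proof.
move=> treeS regS; have [[s _]|nS] := pselect (exists s : S, True).
  by exists (orientation_at treeS regS s);
    have [] := at_consistent treeS regS s.
by exists set0 => s; case: nS; exists s.
Qed.

Lemma sep_iso_regular (S S' : sep_data) : sep_iso S S' -> regular S' ->
  regular S.
Proof.
move=> [f [g [fg gf hf hg [fN gN]]]] regS' s; rewrite /small => /hf.
by rewrite fN; exact: regS'.
Qed.

Theorem theorem4p15 (R : realType) :
  [/\ (forall S : sep_data, tree_set S ->
        ((exists T : graph_space R, tree_like T /\ sep_iso S (edge_tree_set T))
           <-> regular S)),
      (forall (S : sep_data) (treeS : tree_set S) (regS : regular S)
              (O' : set S) (orO' : orientation O'),
        let T := tree_space R treeS regS orO' in
        tree_like T /\ sep_iso S (edge_tree_set T)) &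
      (forall T' : graph_space R, tree_like T' ->
        exists (treeT : tree_set (edge_tree_set T'))
               (regT : regular (edge_tree_set T')),
        forall (O' : set (edge_tree_set T')) (orO' : orientation O'),
          graph_like_iso T' (tree_space R treeT regT orO'))].
Proof.
split.
- move=> S treeS; split=> [[T [tlT iso]]|regS].
    by apply: sep_iso_regular iso _; exact: edge_regular.
  have [Q orQ] := orientation_ex treeS regS.
  exists (tree_space R treeS regS orQ); split;
    first exact: tree_space_tree_like.
  exact: tree_space_iso.
- move=> S treeS regS O' orO'; split; first exact: tree_space_tree_like.
  exact: tree_space_iso.
- move=> T' tlT; exists (edge_tree_set_tree_set tlT), (edge_regular tlT) =>
    O' orO'.
  exact: tree_like_iso.
Qed.
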